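(* Let $\alpha\in(0,2)$ and let $\varepsilon_t$, $\gamma_{n,\varepsilon}$, $\rho_{n,\varepsilon}$, $Y_0,Y_1,\dots$, $\ell^{\alpha}\log\ell$, $X_n(\mathbf a)$, $\widetilde X_n(\mathbf a)$, $Y(\mathbf a)$, $\widetilde Y(\mathbf a)$ be as in the context. Then the finite-dimensional distributions converge: $$(X_n(\mathbf a))_{\mathbf a\in\ell^{\alpha}\log\ell}\xrightarrow{\text{fidi}}(Y(\mathbf a))_{\mathbf a\in\ell^{\alpha}\log\ell},\qquad (\widetilde X_n(\mathbf a))_{\mathbf a\in\ell^{\alpha}\log\ell}\xrightarrow{\text{fidi}}(\widetilde Y(\mathbf a))_{\mathbf a\in\ell^{\alpha}\log\ell},$$ i.e. for every finite collection $\mathbf a^{(1)},\dots,\mathbf a^{(r)}\in\ell^\alpha\log\ell$, $(X_n(\mathbf a^{(1)}),\dots,X_n(\mathbf a^{(r)}))$ converges in distribution to $(Y(\mathbf a^{(1)}),\dots,Y(\mathbf a^{(r)}))$ as $n\to\infty$, and similarly for $\widetilde X_n,\widetilde Y$.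
   Context: Let $(\varepsilon_t)_{t\in\mathbb Z}$ be i.i.d. symmetric $\alpha$-stable random variables with $E e^{\mathrm i u\varepsilon_1}=e^{-|u|^\alpha}$, $\alpha\in(0,2)$. For $n\ge1$ and $0\le h\le n-1$ put $\gamma_{n,\varepsilon}(h)=\frac1n\sum_{t=1}^{n-h}\varepsilon_t\varepsilon_{t+h}$ and $\rho_{n,\varepsilon}(h)=\gamma_{n,\varepsilon}(h)/\gamma_{n,\varepsilon}(0)$. Let $Y_0,Y_1,Y_2,\dots$ be independent random variables with $Y_0\sim S_{\alpha/2}(\sigma_1,1,0)$ and $Y_1,Y_2,\dots$ i.i.d. $S_\alpha(\sigma_2,0,0)$ (stable laws in the notation $S_\alpha(\sigma,\beta,\mu)$ of Samorodnitsky–Taqqu), where $\sigma_1,\sigma_2>0$ depend only on $\alpha$ and are the constants for which, for every $m\ge1$, $\big(n\gamma_{n,\varepsilon}(0)/n^{2/\alpha},\ n\gamma_{n,\varepsilon}(h)/(n\log n)^{1/\alpha},\ h=1,\dots,m\big)$ converges in distribution to $(Y_0,Y_1,\dots,Y_m)$. Let $\ell^{\alpha}\log\ell$ be the set of real sequences $\mathbf a=(a_1,a_2,\dots)$ with $\sum_k|a_k|^\alpha<\infty$ and $\sum_k|a_k|^\alpha\log^+(1/|a_k|)<\infty$ (terms with $a_k=0$ are $0$). For $\mathbf a\in\ell^\alpha\log\ell$ define $X_n(\mathbf a)=(n\log n)^{-1/\alpha}\sum_{k=1}^{n-1}a_k\,[n\gamma_{n,\varepsilon}(k)]$, $\widetilde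 X_n(\mathbf a)=(n/\log n)^{1/\alpha}\sum_{k=1}^{n-1}a_k\rho_{n,\varepsilon}(k)$, $Y(\mathbf a)=\sum_{k=1}^\infty a_kY_k$ (an a.s. convergent series) and $\widetilde Y(\mathbf a)=Y(\mathbf a)/Y_0$. *)

(* Defs.v *)
From HB Require Import structures.
From mathcomp Require Import all_boot all_order all_algebra.
From mathcomp Require Import all_classical all_reals all_analysis.
Set Implicit Arguments. Unset Strict Implicit. Unset Printing Implicit Defensive.
Import Order.TTheory GRing.Theory Num.Theory.
Import numFieldNormedType.Exports.
Local Open Scope classical_set_scope.
Local Open Scope ring_scope.

Section Defs.
Context {R : realType}.

(* Expectation of a real function (used only for bounded measurable ones). *)
Definition Ex {d} {T : measurableType d} (P : probability T R) (f : T -> R) : R :=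
  Rintegral P setT f.

Definition mutually_independent {d} {T : measurableType d} (P : probability T R)
  (X : nat -> T -> R) : Prop :=
  forall (s : seq nat) (B : nat -> set R), uniq s ->
    (forall i, i \in s -> measurable (B i)) ->
    P (\bigcap_(i in [set j | j \in s]) (X i @^-1` B i)) =
    (\prod_(i <- s) P (X i @^-1` B i))%E.

(* log of the characteristic function of S_alpha(sigma, beta, mu)
   (Samorodnitsky--Taqqu, Def. 1.1.6): real and imaginary parts. *)
Definition stable_logcf_re (alpha sigma : R) (u : R) : R :=
  if alpha == 1 then - (sigma * `|u|) else - (sigma `^ alpha * `|u| `^ alpha).
Definition stable_logcf_im (alpha sigma beta mu : R) (u : R) : R :=
  if alpha == 1 then
    - (sigma * `|u| * beta * (2 / pi) * Num.sg u * ln `|u|) + mu * u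
  else sigma `^ alpha * `|u| `^ alpha * beta * Num.sg u * tan (pi * alpha / 2)
       + mu * u.

(* X has law S_alpha(sigma,beta,mu): its characteristic function
   E e^{iuX} = E cos(uX) + i E sin(uX) equals exp(psi(u)). *)
Definition has_stable_law {d} {T : measurableType d} (P : probability T R)
  (X : T -> R) (alpha sigma beta mu : R) : Prop :=
  forall u : R,
    Ex P (fun w => cos (u * X w)) =
      expR (stable_logcf_re alpha sigma u) * cos (stable_logcf_im alpha sigma beta mu u) /\
    Ex P (fun w => sin (u * X w)) =
      expR (stable_logcf_re alpha sigma u) * sin (stable_logcf_im alpha sigma beta mu u).

Definition cvg_in_distribution {d d'} {T : measurableType d} {T' : measurableType d'}
  (r : nat) (P : probability T R) (Xn : nat -> T -> 'rV[R]_r)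
  (Q : probability T' R) (Y : T' -> 'rV[R]_r) : Prop :=
  forall f : 'rV[R]_r -> R, continuous f -> (exists M : R, forall x, `|f x| <= M) ->
    (fun n => Ex P (fun w => f (Xn n w))) @ \oo --> Ex Q (fun w => f (Y w)).

Definition ngamma {T} (eps : nat -> T -> R) (n h : nat) (w : T) : R :=
  \sum_(1 <= t < (n - h).+1) eps t w * eps (t + h) w.
Definition gamma_n {T} (eps : nat -> T -> R) (n h : nat) (w : T) : R :=
  ngamma eps n h w / n%:R.
Definition rho_n {T} (eps : nat -> T -> R) (n h : nat) (w : T) : R :=
  gamma_n eps n h w / gamma_n eps n 0 w.

(* Sequences a = (a_1, a_2, ...) are represented by a : nat -> R, a 0 unused. *)
Definition in_lalogl (alpha : R) (a : nat -> R) : Prop :=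
  (\sum_(1 <= k <oo) (`|a k| `^ alpha)%:E < +oo)%E /\
  (\sum_(1 <= k <oo) (`|a k| `^ alpha * Num.max 0 (ln (`|a k|^-1)))%:E < +oo)%E.

Definition Xn {T} (alpha : R) (eps : nat -> T -> R) (a : nat -> R) (n : nat) (w : T) : R :=
  ((n%:R * ln n%:R) `^ alpha^-1)^-1 * \sum_(1 <= k < n) a k * ngamma eps n k w.
Definition Xtn {T} (alpha : R) (eps : nat -> T -> R) (a : nat -> R) (n : nat) (w : T) : R :=
  (n%:R / ln n%:R) `^ alpha^-1 * \sum_(1 <= k < n) a k * rho_n eps n k w.
Definition Ya {T} (Y : nat -> T -> R) (a : nat -> R) (w : T) : R :=
  limn (fun N => \sum_(1 <= k < N) a k * Y k w).
Definition Yta {T} (Y : nat -> T -> R) (a : nat -> R) (w : T) : R :=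
  Ya Y a w / Y 0 w.

End Defs.

(* Main.v *)
(* Both families of limits reduce to one estimate for martingale transforms
   sum_t X_t Z_t, where Z_t depends only on X_s for s < t: since the X_t are
   symmetric alpha-stable, P(|sum_t X_t Z_t| > 2) is at most a constant times
   sum_t E min(1, |Z_t|^alpha).
   - Z_t constant: weak-type tails of linear combinations.
   - Z_t = a_t 1{no partial sum has exceeded y before t}: a maximal inequality,
     hence almost sure convergence of sum_k a_k Y_k.
   - Z_t = sum_(s < t) a_(t-s) X_s: by the first item, E min(1, |Z_t|^alpha / L)
     is of order (log L / L) sum_k |a_k|^alpha, and with L = n log n the n terms
     add up to O(sum_k |a_k|^alpha), uniformly in n.
   The last bound controls the error of truncating a to finitely many lags; the
   truncated statistics are linear images of the vector in the assumed joint
   limit theorem. The sample autocorrelations follow by dividing by the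
   coordinate n gamma(0) / n^(2/alpha), whose limit Y_0 has no atom at 0. *)

Require Import Defs.
From HB Require Import structures.
From mathcomp Require Import all_boot all_order all_algebra.
From mathcomp Require Import all_classical all_reals all_analysis.
From mathcomp Require Import measurable_realfun ring lra.
Import Order.TTheory GRing.Theory Num.Theory.
Import numFieldNormedType.Exports.
Local Open Scope classical_set_scope.
Local Open Scope ring_scope.
Set Implicit Arguments.
Unset Strict Implicit.
Unset Printing Implicit Defensive.

(** * Bounded measurable functions and expectations *)

Section Expectation.
Context {R : realType}.

(** The summands have infinite variance and only their characteristic functions are given, so
    Chebyshev does not apply directly. The substitute is the inequality
    [min(1, x^2) <= 12 (1 - sin x / x)]: the right side averages [1 - cos (x u)] over [u] in [0, 1],
    so Fubini bounds a truncated second moment by an integral of the characteristic function. The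
    truncation in [min(1, |Z_t|^alpha)] cannot be dropped: in the quadratic form [Z_t] is itself a
    stable linear form, whose [alpha]-th moment is infinite unless it vanishes. Only a weak bound
    [P (|Z_t|^alpha > v) <= B / v] holds, and integrating it over dyadic levels costs a factor equal
    to the number of levels. About log n levels are needed, which is the logarithm in the
    normalisation n log n. The transform estimate serves two sequences: [eps] with [c = 1], and [Y]
    with [c] equal to [sigma2 ^ alpha]. Since [Y 0] is skewed, the hypotheses on characteristic
    functions concern indices [t > 0] only. *)

Definition bounded_mfun {d} {T : measurableType d} (f : T -> R) : Prop :=
  measurable_fun setT f /\ exists M : R, forall x, `|f x| <= M.

Section BoundedMfun.
Context {d : measure_display} {T : measurableType d}.
Implicit Types f g : T -> R.

Lemma measurable_set_lt (f : T -> R) (a : R) : measurable_fun setT f ->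
  measurable [set w | a < f w].
Proof.
move=> mf; have := mf measurableT `]a, +oo[%classic (measurable_itv _).
by rewrite setTI; congr (measurable _); apply/seteqP; split => w /=;
  rewrite in_itv /= andbT.
Qed.

Lemma measurable_bigsum (I : Type) (r : seq I) (p : pred I) (F : I -> T -> R) :
  (forall i, p i -> measurable_fun setT (F i)) ->
  measurable_fun setT (fun x => \sum_(i <- r | p i) F i x).
Proof.
move=> mF; elim: r => [|i r IH].
  rewrite (_ : (fun x => _) = fun=> 0); first exact: measurable_cst.
  by apply/funext => x; rewrite big_nil.
rewrite (_ : (fun x => _) = fun x =>
  if p i then F i x + \sum_(i <- r | p i) F i x else \sum_(i <- r | p i) F i x).
  by case E : (p i) => //; apply: measurable_funD => //; exact: mF.
by apply/funext => x; rewrite big_cons.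
Qed.

Lemma bounded_mfun_cst (c : R) : bounded_mfun (fun _ : T => c).
Proof. by split; [exact: measurable_cst|exists `|c|]. Qed.

Lemma bounded_mfunD f g : bounded_mfun f -> bounded_mfun g ->
  bounded_mfun (fun x => f x + g x).
Proof.
move=> [mf [M hM]] [mg [N hN]]; split; first exact: measurable_funD.
by exists (M + N) => x; apply: (le_trans (ler_normD _ _)); exact: lerD.
Qed.

Lemma bounded_mfunM f g : bounded_mfun f -> bounded_mfun g ->
  bounded_mfun (fun x => f x * g x).
Proof.
move=> [mf [M hM]] [mg [N hN]]; split; first exact: measurable_funM.
by exists (M * N) => x; rewrite normrM ler_pM.
Qed.

Lemma bounded_mfunZ (c : R) f : bounded_mfun f ->
  bounded_mfun (fun x => c * f x).
Proof. by move=> bf; exact: bounded_mfunM (bounded_mfun_cst c) bf. Qed.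

Lemma bounded_mfunB f g : bounded_mfun f -> bounded_mfun g ->
  bounded_mfun (fun x => f x - g x).
Proof.
move=> bf bg; rewrite (_ : (fun x => _) = fun x => f x + -1 * g x).
  by apply: bounded_mfunD => //; exact: bounded_mfunZ.
by apply/funext => x; rewrite mulN1r.
Qed.

Lemma bounded_mfun_sum (I : Type) (r : seq I) (p : pred I) (F : I -> T -> R) :
  (forall i, p i -> bounded_mfun (F i)) ->
  bounded_mfun (fun x => \sum_(i <- r | p i) F i x).
Proof.
move=> bF; elim: r => [|i r IH].
  rewrite (_ : (fun x => _) = fun=> 0); first exact: bounded_mfun_cst.
  by apply/funext => x; rewrite big_nil.
rewrite (_ : (fun x => _) = fun x =>
  if p i then F i x + \sum_(i <- r | p i) F i x else \sum_(i <- r | p i) F i x).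
  by case E : (p i) => //; apply: bounded_mfunD => //; exact: bF.
by apply/funext => x; rewrite big_cons.
Qed.

Lemma bounded_mfun_indic (A : set T) : measurable A ->
  bounded_mfun (\1_A : T -> R).
Proof.
move=> mA; split; first exact: measurable_indic.
by exists 1 => x; rewrite indicE; case: (_ \in _); rewrite ?normr1 ?normr0.
Qed.

Lemma bounded_mfun_norm f : bounded_mfun f -> bounded_mfun (fun x => `|f x|).
Proof.
move=> [mf [M hM]]; split; first exact: measurableT_comp.
by exists M => x; rewrite normr_id.
Qed.

Lemma bounded_mfun_comp {d' : measure_display} {T' : measurableType d'}
  (h : T' -> T) f : bounded_mfun f -> measurable_fun setT h ->
  bounded_mfun (fun x => f (h x)).
Proof.
by move=> [mf [M hM]] mh; split; [exact: measurableT_comp|exists M => x].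
Qed.

Lemma bounded_mfun_min1 f : measurable_fun setT f -> (forall x, 0 <= f x) ->
  bounded_mfun (fun x => Num.min 1 (f x)).
Proof.
move=> mf f0; split; first by apply: measurable_minr => //; exact: measurable_cst.
exists 1 => x; rewrite ger0_norm ?le_min ?ler01 ?f0//.
by rewrite ge_min lexx.
Qed.

Lemma bounded_mfun_cos f : measurable_fun setT f ->
  bounded_mfun (fun x => cos (f x)).
Proof.
move=> mf; split; last by exists 1 => x; exact: cos_max.
apply: (measurableT_comp _ mf).
by apply: continuous_measurable_fun; exact: continuous_cos.
Qed.

Lemma bounded_mfun_sin f : measurable_fun setT f ->
  bounded_mfun (fun x => sin (f x)).
Proof.
move=> mf; split; last by exists 1 => x; exact: sin_max.
apply: (measurableT_comp _ mf).
by apply: continuous_measurable_fun; exact: continuous_sin.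
Qed.

End BoundedMfun.

Section Ex.
Context {d : measure_display} {T : measurableType d}.
Variable P : probability T R.
Implicit Types f g : T -> R.

Lemma bounded_mfun_integrable f : bounded_mfun f ->
  P.-integrable setT (EFin \o f).
Proof.
move=> [mf [M hM]]; apply: (measurable_bounded_integrable measurableT _ mf).
  exact: fin_num_fun_lty.
exists M; split; first exact: num_real.
by move=> x Mx y _ /=; exact: le_trans (hM y) (ltW Mx).
Qed.

Lemma EFin_Ex f : bounded_mfun f -> (Ex P f)%:E = (\int[P]_x (f x)%:E)%E.
Proof.
move=> bf; rewrite /Ex /Rintegral fineK//.
exact/integrable_fin_num/bounded_mfun_integrable.
Qed.

Lemma Ex_cst (c : R) : Ex P (fun=> c) = c.
Proof.
rewrite /Ex Rintegral_cst// -[RHS]mulr1; congr (_ * _).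
by rewrite -[RHS]/(fine 1%E); congr fine; exact: probability_setT.
Qed.

Lemma ExD f g : bounded_mfun f -> bounded_mfun g ->
  Ex P (fun x => f x + g x) = Ex P f + Ex P g.
Proof.
by move=> bf bg; rewrite /Ex RintegralD//; exact: bounded_mfun_integrable.
Qed.

Lemma ExB f g : bounded_mfun f -> bounded_mfun g ->
  Ex P (fun x => f x - g x) = Ex P f - Ex P g.
Proof.
by move=> bf bg; rewrite /Ex RintegralB//; exact: bounded_mfun_integrable.
Qed.

Lemma ExZ (c : R) f : bounded_mfun f -> Ex P (fun x => c * f x) = c * Ex P f.
Proof.
by move=> bf; rewrite /Ex RintegralZl//; exact: bounded_mfun_integrable.
Qed.

Lemma Ex_sum (I : Type) (r : seq I) (p : pred I) (F : I -> T -> R) :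
  (forall i, p i -> bounded_mfun (F i)) ->
  Ex P (fun x => \sum_(i <- r | p i) F i x) = \sum_(i <- r | p i) Ex P (F i).
Proof.
move=> bF; elim: r => [|i r IH].
  rewrite big_nil -[RHS](Ex_cst 0); congr Ex.
  by apply/funext => x; rewrite big_nil.
rewrite big_cons; case: ifP => pi; last first.
  by rewrite -IH; congr Ex; apply/funext => x; rewrite big_cons pi.
rewrite -IH -ExD; [|exact: bF|exact: bounded_mfun_sum].
by congr Ex; apply/funext => x; rewrite big_cons pi.
Qed.

Lemma Ex_ge0 f : (forall x, 0 <= f x) -> 0 <= Ex P f.
Proof. by move=> f0; apply: Rintegral_ge0. Qed.

Lemma le_Ex f g : bounded_mfun f -> bounded_mfun g ->
  (forall x, f x <= g x) -> Ex P f <= Ex P g.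
Proof.
by move=> bf bg fg; apply: le_Rintegral => //; exact: bounded_mfun_integrable.
Qed.

Lemma ler_norm_Ex f : bounded_mfun f -> `|Ex P f| <= Ex P (fun x => `|f x|).
Proof.
by move=> bf; apply: le_normr_Rintegral => //; exact: bounded_mfun_integrable.
Qed.

Lemma Ex_indic (A : set T) : measurable A -> (Ex P (\1_A))%:E = P A.
Proof.
by move=> mA; rewrite EFin_Ex ?integral_indic ?setIT//; exact: bounded_mfun_indic.
Qed.

Lemma le_Ex_indic (A B : set T) : measurable A -> measurable B ->
  A `<=` B -> Ex P (\1_A) <= Ex P (\1_B).
Proof.
move=> mA mB AB; apply: le_Ex; [exact: bounded_mfun_indic..|move=> x].
rewrite !indicE; case: (boolP (x \in A)) => [|_]; last by rewrite ler0n.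
by rewrite inE => /AB Bx; rewrite mem_set.
Qed.

Lemma Ex_indic_le1 (A : set T) : measurable A -> Ex P (\1_A) <= 1.
Proof.
move=> mA; rewrite -[leRHS](Ex_cst 1); apply: le_Ex.
- exact: bounded_mfun_indic.
- exact: bounded_mfun_cst.
- by move=> x; rewrite indicE; case: (_ \in _).
Qed.

Lemma dominated_cvg_Ex (fn : nat -> T -> R) f (M : R) :
  (forall n, measurable_fun setT (fn n)) -> measurable_fun setT f ->
  (forall n x, `|fn n x| <= M) ->
  {ae P, forall x, fn ^~ x @ \oo --> f x} ->
  Ex P (fn n) @[n --> \oo] --> Ex P f.
Proof.
move=> mfn mf fnM cv.
have M0 : 0 <= M by exact: le_trans (fnM 0%N point).
have [|||||If _ Icvg] := @dominated_convergence _ T R P setT measurableT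
  (fun n => EFin \o fn n) (EFin \o f) (fun=> M%:E).
- by move=> n; exact/measurable_EFinP.
- exact/measurable_EFinP.
- case: cv => N [mN N0 sN]; exists N; split => // x /= nx; apply: sN => /= cx.
  by apply: nx => _; apply: cvg_comp cx _.
- exact: (bounded_mfun_integrable (bounded_mfun_cst M)).
- by apply: aeW => x n _; rewrite /= lee_fin.
rewrite /Ex /Rintegral; apply: fine_cvg; rewrite fineK; last first.
  exact: integrable_fin_num.
exact: Icvg.
Qed.

End Ex.

Section Fubini.
Context {d1 d2 : measure_display} {T1 : measurableType d1} {T2 : measurableType d2}.
Variables (P1 : probability T1 R) (P2 : probability T2 R) (h : T1 * T2 -> R).
Hypothesis bh : bounded_mfun h.

Lemma bounded_mfun_pair1 x : bounded_mfun (fun y => h (x, y)).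
Proof. exact: bounded_mfun_comp bh (pair1_measurable x). Qed.

Lemma bounded_mfun_pair2 y : bounded_mfun (fun x => h (x, y)).
Proof. exact: bounded_mfun_comp bh (pair2_measurable y). Qed.

Let ih : (P1 \x P2)%E.-integrable setT (EFin \o h).
Proof.
move: bh => [mf [M hM]].
apply: (measurable_bounded_integrable measurableT _ mf).
  suff : ((P1 \x P2) (setT `*` setT) < +oo)%E by rewrite setXTT.
  rewrite product_measure1E//; apply: lte_mul_pinfty => //.
  - by rewrite ge0_fin_numE//; exact: fin_num_fun_lty.
  - exact: fin_num_fun_lty.
exists M; split; first exact: num_real.
by move=> x Mx y _ /=; exact: le_trans (hM y) (ltW Mx).
Qed.

Lemma bounded_mfun_Ex1 : bounded_mfun (fun x => Ex P2 (fun y => h (x, y))).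
Proof.
split; last first.
  case: (bh) => _ [M hM]; exists M => x.
  apply: (le_trans (ler_norm_Ex _ _)); first exact: bounded_mfun_pair1.
  rewrite -[leRHS](Ex_cst P2); apply: le_Ex => //.
  - exact/bounded_mfun_norm/bounded_mfun_pair1.
  - exact: bounded_mfun_cst.
apply/measurable_EFinP; apply: eq_measurable_fun (measurable_fubini_F ih).
move=> x _; rewrite /= EFin_Ex//; exact: bounded_mfun_pair1.
Qed.

Lemma Ex_product1 :
  Rintegral (P1 \x P2)%E setT h = Ex P1 (fun x => Ex P2 (fun y => h (x, y))).
Proof.
rewrite /Rintegral -(integral12_prod_meas1 ih); congr fine.
by apply: eq_integral => x _; rewrite EFin_Ex//; exact: bounded_mfun_pair1.
Qed.

Lemma Ex_fubini : Ex P1 (fun x => Ex P2 (fun y => h (x, y))) =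
                  Ex P2 (fun y => Ex P1 (fun x => h (x, y))).
Proof.
have := Fubini ih.
rewrite (eq_integral (fun x => (Ex P2 (fun y => h (x, y)))%:E)); last first.
  by move=> x _; rewrite EFin_Ex//; exact: bounded_mfun_pair1.
rewrite [RHS](eq_integral (fun y => (Ex P1 (fun x => h (x, y)))%:E)); last first.
  by move=> y _; rewrite EFin_Ex//; exact: bounded_mfun_pair2.
by rewrite /Ex /Rintegral => ->.
Qed.

End Fubini.
End Expectation.

(** * Events depending on the past *)

Section Independence.
Context {R : realType} {d : measure_display} {T : measurableType d}.
Variable P : probability T R.

Lemma Ex_distribution {d0} {T0 : measurableType d0} (f : {mfun T >-> T0})
  (h : T0 -> R) : bounded_mfun h ->
  Ex (distribution P f) h = Ex P (fun w => h (f w)).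
Proof.
move=> bh; rewrite /Ex /Rintegral integral_distribution//.
  by apply/measurable_EFinP; case: bh.
apply: (@bounded_mfun_integrable _ _ _ _ (h \o f)).
exact: bounded_mfun_comp bh _.
Qed.

(** Factorisation on rectangles identifies the joint law with the product of the marginal laws, and
    Fubini does the rest. The target of [f] is an arbitrary measurable space so that [f] can be the
    identity into a coarser sigma-algebra. *)
Lemma Ex_indep {d0} {T0 : measurableType d0} (f : T -> T0) (X : T -> R)
    (h : T0 * R -> R) :
  measurable_fun setT f -> measurable_fun setT X ->
  (forall A B, measurable A -> measurable B ->
    P (f @^-1` A `&` X @^-1` B) = (P (f @^-1` A) * P (X @^-1` B))%E) ->
  bounded_mfun h ->
  Ex P (fun w => h (f w, X w)) =
  Ex P (fun w => Ex P (fun w' => h (f w, X w'))).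
Proof.
move=> mf mX indep bh.
pose f' : {mfun T >-> T0} := HB.pack f (isMeasurableFun.Build _ _ _ _ f mf).
pose X' : {mfun T >-> R} := HB.pack X (isMeasurableFun.Build _ _ _ _ X mX).
have mfX : measurable_fun setT (fun w => (f w, X w)) by exact: measurable_fun_pair.
pose fX : {mfun T >-> (T0 * R)%type} := HB.pack (fun w => (f w, X w))
  (isMeasurableFun.Build _ _ _ _ (fun w => (f w, X w)) mfX).
have /= E := @product_measure_unique _ _ _ _ _ (distribution P f')
  (distribution P X') (distribution P fX).
rewrite -(Ex_distribution fX bh).
transitivity (Rintegral (distribution P f' \x distribution P X')%E setT h).
  rewrite /Ex /Rintegral; congr fine.
  apply: eq_measure_integral => A mA _; apply/esym.
  by apply: E => //= B C mB mC; rewrite /distribution /pushforward -indep.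
rewrite Ex_product1// Ex_distribution; last exact: (bounded_mfun_Ex1 (distribution P f') _ bh).
congr (Ex P _); apply/funext => w.
by rewrite Ex_distribution//; exact: bounded_mfun_pair1.
Qed.

Variable X : nat -> T -> R.
Hypothesis mX : forall t, measurable_fun setT (X t).
Hypothesis indepX : mutually_independent P X.

(** A pi-system: boxes intersect coordinatewise, and unconstrained coordinates are given the whole
    line. *)
Definition cylinder_before (t : nat) : set (set T) :=
  [set E | exists2 B : nat -> set R, (forall s, measurable (B s)) &
     E = \bigcap_(s in [set s | (s < t)%N]) (X s @^-1` B s)].

(** The sample space with the sigma-algebra generated by the [X s], [s < t]. Predictability of a
    process [Z] becomes plain measurability of [Z t] on this type. *)
Definition past_type (t : nat) := g_sigma_algebraType (cylinder_before t).

Lemma setI_closed_cylinder_before t : setI_closed (cylinder_before t).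
Proof.
move=> _ _ [B mB ->] [C mC ->]; exists (fun s => B s `&` C s).
  by move=> s; exact: measurableI.
by rewrite -bigcapI; apply: eq_bigcapr => s _; rewrite preimage_setI.
Qed.

Lemma cylinder_before_measurable t : cylinder_before t `<=` measurable.
Proof.
move=> _ [B mB ->]; apply: bigcap_measurableType => s _.
by rewrite -[X in measurable X]setTI; exact: mX.
Qed.

Lemma past_measurable_set t (E : set (past_type t)) : measurable E ->
  measurable (E : set T).
Proof.
apply: smallest_sub; first exact: sigma_algebra_measurable.
exact: cylinder_before_measurable.
Qed.

Lemma past_id_measurable t :
  measurable_fun setT (id : T -> past_type t).
Proof. by move=> _ E mE; rewrite setTI; exact: past_measurable_set mE. Qed.

Lemma past_measurable_fun t {d'} {T' : measurableType d'}
  (Z : past_type t -> T') : measurable_fun setT Z ->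
  measurable_fun setT (Z : T -> T').
Proof.
move=> mZ _ B mB; have := mZ measurableT B mB; rewrite !setTI.
exact: past_measurable_set.
Qed.

Lemma past_X_measurable s t : (s < t)%N ->
  measurable_fun setT (X s : past_type t -> R).
Proof.
move=> st _ B mB; rewrite setTI; apply: sub_sigma_algebra.
exists (fun i => if i == s then B else setT).
  by move=> i; case: ifP.
apply/seteqP; split => [w Bw i /= it|w /(_ s st) /=]; last by rewrite eqxx.
by case: ifPn => // /eqP ->.
Qed.

Lemma past_mono_measurable {d'} {T' : measurableType d'} s t (Z : T -> T') :
  (s <= t)%N -> measurable_fun setT (Z : past_type s -> T') ->
  measurable_fun setT (Z : past_type t -> T').
Proof.
move=> st mZ _ B mB; have := mZ measurableT B mB; rewrite !setTI.
apply: smallest_sub; first exact: sigma_algebra_measurable.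
move=> _ [C mC ->]; apply: sub_sigma_algebra.
exists (fun i => if (i < s)%N then C i else setT).
  by move=> i; case: ifP.
apply/seteqP; split => [w Cw i /= it|w Cw i /= si].
  by case: ifP => // si; exact: Cw.
by have := Cw i (leq_trans si st); rewrite /= si.
Qed.

(** For fixed [B] both sides are finite measures in [E], namely a restriction and a multiple of [P].
    They agree on cylinders by mutual independence, hence on the generated sigma-algebra. *)
Lemma past_indep t (E : set (past_type t)) (B : set R) :
  measurable E -> measurable B ->
  P (E `&` X t @^-1` B) = (P E * P (X t @^-1` B))%E.
Proof.
move=> mE mB.
have mXB : measurable (X t @^-1` B) by rewrite -[Y in measurable Y]setTI; exact: mX.
have PB0 : 0 <= fine (P (X t @^-1` B)) by apply: fine_ge0; exact: measure_ge0.
pose r : {nonneg R} := NngNum PB0.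
have PBE : r%:num%:E = P (X t @^-1` B) by rewrite /= fineK//; exact: fin_num_measure.
have mscE A : (P A * P (X t @^-1` B))%E = mscale r P A.
  by rewrite /mscale PBE muleC.
transitivity (mscale r P E); last exact/esym/mscE.
apply: (@g_sigma_algebra_measure_unique _ R T (cylinder_before t)
  (@cylinder_before_measurable t) (fun=> setT) _ _ (mrestr P mXB)
  (mscale r P) (@setI_closed_cylinder_before t) _ _ E mE).
- move=> _; exists (fun=> setT) => //.
  by apply/seteqP; split => [w _ i _|].
- by apply/seteqP; split => [//|w _]; exists 0%N.
- move=> _ [C mC ->].
  (* The cylinder [C] is completed by [B] at index [t], so that independence over the indices
     [0, ..., t] covers the intersection in one go. *)
  pose D i := if i == t then B else C i.
  have mD i : measurable (D i) by rewrite /D; case: ifP.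
  have DC i : (i < t)%N -> D i = C i.
    by rewrite /D; case: eqP => // ->; rewrite ltnn.
  have Dt : D t = B by rewrite /D eqxx.
  have iotaE n : [set j | j \in iota 0 n] = [set s | (s < n)%N].
    by apply/seteqP; split => i /=; rewrite mem_iota add0n.
  have PC n : (n <= t)%N ->
      P (\bigcap_(s in [set s | (s < n)%N]) (X s @^-1` D s)) =
      (\prod_(s <- iota 0 n) P (X s @^-1` D s))%E.
    move=> nt; rewrite -indepX ?iota_uniq//.
    by rewrite iotaE.
  have -> : \bigcap_(s in [set s | (s < t)%N]) (X s @^-1` C s) =
     \bigcap_(s in [set s | (s < t)%N]) (X s @^-1` D s).
    by apply: eq_bigcapr => s /= st; rewrite DC.
  transitivity (P (\bigcap_(s in [set s | (s < t)%N]) (X s @^-1` D s))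
    * P (X t @^-1` B))%E; last exact: mscE.
  rewrite (PC t (leqnn t)).
  transitivity (\prod_(s <- iota 0 t.+1) P (X s @^-1` D s))%E; last first.
    by rewrite -addn1 iotaD big_cat big_seq1 add0n Dt.
  rewrite -indepX ?iota_uniq// iotaE; apply: (congr1 P).
  apply/seteqP; split => [w [Dw Btw] i /=|w Dw].
    rewrite ltnS leq_eqVlt => /orP[/eqP ->|it]; first by rewrite Dt.
    exact: Dw.
  split => [i /= it|]; first by apply: Dw; rewrite /= ltnS ltnW.
  by rewrite -Dt; apply: Dw; rewrite /= ltnS.
- move=> _; apply: le_lt_trans (_ : 1 < +oo)%E; last by rewrite ltry.
  by apply: probability_le1; exact: measurableI.
Qed.

(** The freezing rule: whatever depends on the past may be held constant while averaging over
    [X t]. *)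
Lemma Ex_past t (h : past_type t * R -> R) : bounded_mfun h ->
  Ex P (fun w => h (w, X t w)) = Ex P (fun w => Ex P (fun w' => h (w, X t w'))).
Proof.
move=> bh; have := Ex_indep (@past_id_measurable t) (mX t) _ bh; apply.
by move=> A B mA mB; exact: past_indep.
Qed.

End Independence.

(** * The kernel 1 - sin x / x *)

Section Sinc.
Context {R : realType}.
Implicit Types x u : R.

(** The mean of [cos (x u)] for [u] uniform on [0, 1], which ties it to characteristic functions. *)
Definition sinc x : R := if x == 0 then 1 else sin x / x.

Lemma sqr_normr x : `|x| ^+ 2 = x ^+ 2.
Proof. exact: (real_normK (num_real x)). Qed.

Lemma sinMVT x : 0 < x -> exists2 c, 0 < c < x & sin x = cos c * x.
Proof.
move=> x0.
have dsin y : y \in `]0, x[ -> is_derive y 1 (@sin R) (cos y).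
  by move=> _; exact: is_derive_sin.
have [c] := MVT x0 dsin (continuous_subspaceT (@continuous_sin R)).
rewrite sin0 !subr0 in_itv /= => cx E; exists c => //.
Qed.

Lemma ler_norm_sin x : `|sin x| <= `|x|.
Proof.
wlog x0 : x / 0 < x => [hw|].
  have [x0|x0|->] := ltgtP x 0; last by rewrite sin0.
    by rewrite -normrN -sinN -[leRHS]normrN hw// oppr_gt0.
  exact: hw.
have [c _ ->] := sinMVT x0.
by rewrite normrM ler_piMl// cos_max.
Qed.

Lemma cosE_sin_half x : cos x = 1 - 2 * sin (x / 2) ^+ 2.
Proof.
have {1}-> : x = (x / 2) *+ 2 by rewrite -mulr_natr divfK.
by rewrite cos_mulr2n cos2sin2 -mulr_natl; lra.
Qed.

Lemma onem_cos_ge0 x : 0 <= 1 - cos x.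
Proof. by rewrite subr_ge0 cos_le1. Qed.

Lemma onem_cos_le x : 1 - cos x <= x ^+ 2 / 2.
Proof.
rewrite cosE_sin_half.
have : sin (x / 2) ^+ 2 <= (x / 2) ^+ 2.
  rewrite -[leLHS]sqr_normr -[leRHS]sqr_normr.
  by rewrite lerXn2r ?nnegrE// ler_norm_sin.
by rewrite expr_div_n; lra.
Qed.

Lemma sub_sin_le x : `|x| <= 1 -> `|x - sin x| <= x ^+ 2.
Proof.
wlog x0 : x / 0 < x => [hw|].
  have [x0 x1|x0|->] := ltgtP x 0; last by rewrite sin0 subrr normr0 sqr_ge0.
    rewrite -normrN opprB -[x in leRHS]opprK sqrrN -[sin x]opprK -sinN addrC.
    by apply: hw; rewrite ?oppr_gt0// normrN.
  exact: hw.
rewrite gtr0_norm// => x1.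
have [c /andP[c0 cx] ->] := sinMVT x0.
have := onem_cos_le c; have := onem_cos_ge0 c => h1 h2.
have -> : x - cos c * x = (1 - cos c) * x by rewrite mulrBl mul1r.
rewrite ger0_norm ?mulr_ge0 ?(ltW x0)// expr2 ler_wpM2r ?(ltW x0)//.
nra.
Qed.

Lemma sincN x : sinc (- x) = sinc x.
Proof. by rewrite /sinc oppr_eq0; case: ifP => // _; rewrite sinN invrN mulrNN. Qed.

(** For [x >= 2], [sin x / x <= 1/2]. For [0 < x < 2] the double-angle formula gives [sin x / x <=
    cos (x/2) = 1 - 2 sin(x/4)^2], and [sin (x/4) >= 7/8 * x/4] since the cosine is at least 7/8 on
    [0, 1/2]. So [1 - sinc x >= 49/512 * x^2], and 12 exceeds 512/49. *)
Lemma min1_sqr_le_sinc x : Num.min 1 (x ^+ 2) <= 12 * (1 - sinc x).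
Proof.
wlog x0 : x / 0 < x => [hw|].
  have [x0|x0|->] := ltgtP x 0.
  - by rewrite -sincN -sqrrN hw// oppr_gt0.
  - exact: hw.
  - by rewrite /sinc eqxx subrr mulr0 expr0n /= ge_min lexx orbT.
rewrite /sinc gt_eqF//.
have [x2|x2] := leP 2 x.
  have : sin x / x <= 1 / 2.
    rewrite ler_pdivrMr//; have := sin_le1 x; lra.
  by move=> h; rewrite ge_min; apply/orP; left; lra.
rewrite ge_min; apply/orP; right.
have cx2 : 0 <= cos (x / 2).
  have := onem_cos_le (x / 2); nra.
have sx : sin x / x <= cos (x / 2).
  rewrite ler_pdivrMr// {1}(_ : x = (x / 2) *+ 2); last by rewrite -mulr_natr divfK.
  rewrite sin_mulr2n -mulr_natl.
  have : sin (x / 2) <= x / 2.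
    apply: (le_trans (ler_norm _)); apply: (le_trans (ler_norm_sin _)).
    by rewrite ger0_norm// divr_ge0// ltW.
  by move=> h; nra.
have x40 : 0 < x / 4 by rewrite divr_gt0.
have [c /andP[c0 cx] E] := sinMVT x40.
have E4 : cos (x / 2) = 1 - 2 * sin (x / 4) ^+ 2.
  rewrite cosE_sin_half; congr (1 - 2 * sin _ ^+ 2).
  by rewrite -mulrA; congr (_ * _); lra.
have := onem_cos_le c => h1.
have hc : 7 / 8 <= cos c by nra.
have hs : 7 / 8 * (x / 4) <= sin (x / 4) by rewrite E ler_wpM2r// ltW.
have : (7 / 8 * (x / 4)) ^+ 2 <= sin (x / 4) ^+ 2.
  by rewrite ler_sqr ?nnegrE ?(le_trans _ hs)// mulr_ge0// ?ltW// divr_ge0.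
move: sx; rewrite E4; set q := sin x / x; set s := sin (x / 4) ^+ 2.
move=> sx hss; nra.
Qed.

Lemma sinc_ge x : `|sinc x| <= 1.
Proof.
rewrite /sinc; case: ifPn => [_|x0]; first by rewrite normr1.
by rewrite normrM normfV ler_pdivrMr ?normr_gt0// mul1r ler_norm_sin.
Qed.

Definition unif01 : probability (measurableTypeR R) R := uniform_prob (@ltr01 R).

Definition clamp01 u : R := Num.min 1 (Num.max 0 u).

Lemma clamp01_itv u : 0 <= clamp01 u <= 1.
Proof. by rewrite /clamp01 le_min ler01 le_max lexx ge_min lexx. Qed.

Lemma measurable_clamp01 : measurable_fun setT (clamp01 : measurableTypeR R -> R).
Proof.
apply: measurable_minr; first exact: measurable_cst.
by apply: measurable_maxr; [exact: measurable_cst|exact: measurable_id].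
Qed.

(* [clamp01] is the identity on the support of [unif01]; it turns bounds that
   hold on [0, 1] into bounds that hold everywhere. *)
Lemma Ex_unif01_cos x : Ex unif01 (fun u => cos (x * clamp01 u)) = sinc x.
Proof.
have [->|x0] := eqVneq x 0.
  rewrite /sinc eqxx -[RHS](Ex_cst unif01); congr (Ex _ _).
  by apply/funext => u; rewrite mul0r cos0.
have mcos : measurable_fun setT
    ((fun u => x * clamp01 u) : measurableTypeR R -> R).
  by apply: measurable_funM; [exact: measurable_cst|exact: measurable_clamp01].
have bc := bounded_mfun_cos mcos.
(* Adding 1 makes the integrand nonnegative, as the integral formula for the uniform law
   requires. *)
suff : Ex unif01 (fun u => 1 + cos (x * clamp01 u)) = 1 + sinc x.
  rewrite ExD//; last exact: bounded_mfun_cst.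
  by rewrite Ex_cst => /addrI.
rewrite /Ex /Rintegral integral_uniform; first last.
- by move=> u; rewrite lee_fin; have := cos_geN1 (x * clamp01 u); lra.
- apply/measurable_EFinP; case: (bounded_mfunD (bounded_mfun_cst 1) bc) => //.
rewrite subr0 invr1 mul1e.
under eq_integral => u.
  rewrite inE /= in_itv /= => /andP[u0 u1].
  rewrite /clamp01 (max_r u0) (min_r u1).
  over.
pose F := (id : R -> R) + x^-1 *: (sin \o ( *%R x)).
have dF u : is_derive u 1 F (1 + cos (x * u)).
  have dM : is_derive u 1 ( *%R x) x.
    by rewrite -[X in is_derive _ _ _ X](mulr1 x); exact: is_deriveZ.
  have := is_derive1_comp (is_derive_sin (x * u)) dM => /(is_deriveZ x^-1) h.
  apply: is_derive_eq (is_deriveD (is_derive_id u 1) h) _.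
  by rewrite /GRing.scale /= mulrCA mulVf// mulr1.
have cF : continuous F.
  by move=> u; apply: differentiable_continuous; apply/derivable1_diffP; exact: ex_derive.
rewrite (@continuous_FTC2 _ _ F) ?ltr01//.
- rewrite /F /sinc (negbTE x0) /= !fctE /= mulr1 mulr0 sin0 scaler0 addr0 subr0.
  by rewrite /GRing.scale /= mulrC.
- apply: continuous_subspaceT => u.
  apply: cvgD; first exact: cvg_cst.
  apply: continuous_comp; last exact: continuous_cos.
  by apply: cvgM; [exact: cvg_cst|exact: cvg_id].
- split.
  + by move=> u _; exact: ex_derive.
  + by apply: cvg_at_right_filter; exact: cF.
  + by apply: cvg_at_left_filter; exact: cF.
- by move=> u _; rewrite derive1E; exact: derive_val.
Qed.

End Sinc.

(** * Martingale transforms *)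

Section MartingaleTransform.
Context {R : realType} {d : measure_display} {T : measurableType d}.
Variable P : probability T R.

Variables (alpha c : R).
Hypotheses (alpha0 : 0 < alpha) (c0 : 0 <= c).

(** By Fubini, the mean of [1 - sinc (z X)] is the average over [u] in [0, 1] of
    [1 - exp (- c |z u|^alpha)], which is at most [c |z|^alpha]. *)
Lemma Ex_min1_sqr_le (X : T -> R) (z : R) : measurable_fun setT X ->
  (forall u, Ex P (fun w => cos (u * X w)) = expR (- (c * `|u| `^ alpha))) ->
  Ex P (fun w => Num.min 1 ((z * X w) ^+ 2)) <= 12 * c * `|z| `^ alpha.
Proof.
move=> mX cfX.
have mzX : measurable_fun setT (fun w => z * X w).
  by apply: measurable_funM => //; exact: measurable_cst.
pose h (p : T * measurableTypeR R) := cos (z * X p.1 * clamp01 p.2).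
have bh : bounded_mfun h.
  apply: bounded_mfun_cos; apply: measurable_funM.
    exact: measurableT_comp mzX measurable_fst.
  exact: measurableT_comp (@measurable_clamp01 R) measurable_snd.
have sincE w : sinc (z * X w) = Ex (@unif01 R) (fun u => h (w, u)).
  by rewrite -Ex_unif01_cos.
have bsinc : bounded_mfun (fun w => sinc (z * X w)).
  have := bounded_mfun_Ex1 P (@unif01 R) bh.
  by congr bounded_mfun; apply/funext => w; rewrite sincE.
apply: (@le_trans _ _ (Ex P (fun w => 12 * (1 - sinc (z * X w))))).
  apply: le_Ex.
  - apply: bounded_mfun_min1; first exact: measurable_funX.
    by move=> x; exact: sqr_ge0.
  - by apply: bounded_mfunZ; apply: bounded_mfunB => //; exact: bounded_mfun_cst.
  - by move=> w; exact: min1_sqr_le_sinc.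
rewrite ExZ; last by apply: bounded_mfunB => //; exact: bounded_mfun_cst.
rewrite -mulrA ler_pM2l// ExB//; last exact: bounded_mfun_cst.
rewrite Ex_cst lerBlDl -lerBlDr.
rewrite (_ : (fun w => sinc _) = (fun w => Ex (@unif01 R) (fun u => h (w, u)))); last first.
  by apply/funext => w; rewrite sincE.
rewrite (Ex_fubini P (@unif01 R) bh).
rewrite -[leLHS](Ex_cst (@unif01 R)); apply: le_Ex.
- exact: bounded_mfun_cst.
- split.
    have [] := bounded_mfun_Ex1 (@unif01 R) P (bounded_mfun_comp bh (@measurable_swap _ _ _ _)).
    by [].
  exists 1 => u; rewrite ler_norml; apply/andP; split.
    rewrite -[leLHS](Ex_cst P); apply: le_Ex; first exact: bounded_mfun_cst.
      exact: bounded_mfun_pair2 bh u.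
    by move=> x; exact: cos_geN1.
  rewrite -[leRHS](Ex_cst P); apply: le_Ex; last by move=> x; exact: cos_le1.
    exact: bounded_mfun_pair2 bh u.
  exact: bounded_mfun_cst.
- move=> u; rewrite /h /=.
  rewrite (_ : (fun x => _) = fun w => cos (z * clamp01 u * X w)); last first.
    by apply/funext => w; rewrite mulrAC.
  rewrite cfX; apply: le_trans (expR_ge1Dx _).
  rewrite lerB// ler_wpM2l//; apply: ge0_ler_powR; rewrite ?nnegrE ?(ltW alpha0)//.
  have /andP[h0 h1] := clamp01_itv u.
  by rewrite normrM ler_piMr// ger0_norm.
Qed.

Local Notation K := (12 * c + 1).

(** The trivial bound 1 covers large [z]. The minimum on the right keeps the bound integrable once
    [z] is replaced by a heavy-tailed predictable variable. *)
Lemma Ex_min1_sqr_le_min1 (X : T -> R) (z : R) : measurable_fun setT X ->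
  (forall u, Ex P (fun w => cos (u * X w)) = expR (- (c * `|u| `^ alpha))) ->
  Ex P (fun w => Num.min 1 ((z * X w) ^+ 2)) <= K * Num.min 1 (`|z| `^ alpha).
Proof.
move=> mX cfX; have [h|h] := leP 1 (`|z| `^ alpha).
  apply: (@le_trans _ _ (Ex P (fun=> 1))); last first.
    by rewrite Ex_cst mulr1 lerDr mulr_ge0.
  apply: le_Ex; last by move=> x; rewrite ge_min lexx.
    apply: bounded_mfun_min1 => [|x]; last exact: sqr_ge0.
    by apply: measurable_funX; apply: measurable_funM => //; exact: measurable_cst.
  exact: bounded_mfun_cst.
apply: (le_trans (Ex_min1_sqr_le z mX cfX)).
by rewrite [leRHS]mulrDl mul1r lerDl powR_ge0.
Qed.

Variable X : nat -> T -> R.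
Hypothesis mX : forall t, measurable_fun setT (X t).
Hypothesis indepX : mutually_independent P X.
Hypothesis cfX : forall t u, (0 < t)%N ->
  Ex P (fun w => cos (u * X t w)) = expR (- (c * `|u| `^ alpha)).
Hypothesis sfX : forall t u, (0 < t)%N -> Ex P (fun w => sin (u * X t w)) = 0.

Variable Z : nat -> T -> R.
Hypothesis pZ : forall t, measurable_fun setT (Z t : past_type X t -> R).

Let mZ t : measurable_fun setT (Z t).
Proof. exact: (past_measurable_fun mX (@pZ t)). Qed.

Let x t w := X t w * Z t w.

Let mx t : measurable_fun setT (x t).
Proof. exact: measurable_funM. Qed.

Let bq t : bounded_mfun (fun w => Num.min 1 (x t w ^+ 2)).
Proof.
apply: bounded_mfun_min1; first exact: measurable_funX.
by move=> w; exact: sqr_ge0.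
Qed.

Lemma Ex_min1_sqr_transform t : (0 < t)%N ->
  Ex P (fun w => Num.min 1 (x t w ^+ 2)) <=
  K * Ex P (fun w => Num.min 1 (`|Z t w| `^ alpha)).
Proof.
move=> t0.
pose h (p : past_type X t * R) := Num.min 1 ((Z t p.1 * p.2) ^+ 2).
have bh : bounded_mfun h.
  apply: bounded_mfun_min1; last by move=> p; exact: sqr_ge0.
  apply: measurable_funX; apply: measurable_funM; last exact: measurable_snd.
  exact: measurableT_comp (@pZ t) measurable_fst.
have := Ex_past mX indepX bh; rewrite /h /= => E.
rewrite (_ : (fun w => Num.min 1 (x t w ^+ 2)) =
  fun w => Num.min 1 ((Z t w * X t w) ^+ 2)); last first.
  by apply/funext => w; rewrite /x mulrC.
have bZ : bounded_mfun (fun w => Num.min 1 (`|Z t w| `^ alpha)).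
  apply: bounded_mfun_min1; last by move=> w; exact: powR_ge0.
  apply: (measurableT_comp (measurable_powR _)).
  exact: measurableT_comp.
rewrite E -ExZ//; apply: le_Ex.
- split.
    apply: (past_measurable_fun mX).
    (* The inner mean depends measurably on the past by Fubini, applied to the image laws of [P] on
       [past_type X t] and under [X t]. *)
    have mXt : measurable_fun setT (X t) by [].
    pose X' : {mfun T >-> R} := HB.pack (X t) (isMeasurableFun.Build _ _ _ _ (X t) mXt).
    pose I' : {mfun T >-> past_type X t} := HB.pack (id : T -> past_type X t)
      (isMeasurableFun.Build _ _ _ _ (id : T -> past_type X t) (past_id_measurable mX (t:=t))).
    have [m _] := bounded_mfun_Ex1 (distribution P I') (distribution P X') bh.
    apply: eq_measurable_fun m => w _.
    by rewrite Ex_distribution//; exact: bounded_mfun_pair1 bh w.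
  exists 1 => w; rewrite ger0_norm.
    rewrite -[leRHS](Ex_cst P); apply: le_Ex.
    + apply: bounded_mfun_min1 => [|w']; last exact: sqr_ge0.
      by apply: measurable_funX; apply: measurable_funM => //; exact: measurable_cst.
    + exact: bounded_mfun_cst.
    + by move=> w'; rewrite ge_min lexx.
  by apply: Ex_ge0 => w'; rewrite le_min ler01 sqr_ge0.
- exact: bounded_mfunZ.
- by move=> w; apply: Ex_min1_sqr_le_min1 => // u; exact: cfX.
Qed.

Let S n w := \sum_(1 <= t < n) sin (x t w).

Let pS n : measurable_fun setT (S n : past_type X n -> R).
Proof.
rewrite /S.
rewrite (_ : (fun w => _) = fun w => \sum_(1 <= t < n | (1 <= t < n)%N) sin (x t w)); last first.
  by apply/funext => w; rewrite big_nat.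
apply: measurable_bigsum => t /andP[_ tn].
apply: (measurableT_comp (f := @sin R)).
  by apply: continuous_measurable_fun; exact: continuous_sin.
apply: measurable_funM; first exact: past_X_measurable.
exact: past_mono_measurable (ltnW tn) (@pZ t).
Qed.

Let bS n : bounded_mfun (S n).
Proof. by apply: bounded_mfun_sum => t _; apply: bounded_mfun_sin. Qed.

(** Given the past, [S n] and [Z n] are constants, and [sin (z X n)] has mean zero for every
    constant [z]. *)
Lemma Ex_sin_sum_orth n : (0 < n)%N -> Ex P (fun w => S n w * sin (x n w)) = 0.
Proof.
move=> n0.
pose h (p : past_type X n * R) := S n p.1 * sin (p.2 * Z n p.1).
have bh : bounded_mfun h.
  apply: bounded_mfunM.
    have [_ hS] := bS n.
    exact: (bounded_mfun_comp (conj (@pS n) hS) measurable_fst).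
  apply: bounded_mfun_sin; apply: measurable_funM; first exact: measurable_snd.
  exact: measurableT_comp (@pZ n) measurable_fst.
have := Ex_past mX indepX bh; rewrite /h /= => ->.
rewrite -[RHS](Ex_cst P 0); congr (Ex P _); apply/funext => w.
rewrite ExZ; last by apply: bounded_mfun_sin; apply: measurable_funM => //; exact: measurable_cst.
rewrite (_ : (fun w' => _) = fun w' => sin (Z n w * X n w')).
  by rewrite sfX// mulr0.
by apply/funext => w'; rewrite mulrC.
Qed.

(** Orthogonality removes the cross terms of the square, and [sin(x)^2 <= min(1, x^2)] handles the
    diagonal. *)
Lemma Ex_sin_sum_sqr n : Ex P (fun w => S n w ^+ 2) <=
  \sum_(1 <= t < n) Ex P (fun w => Num.min 1 (x t w ^+ 2)).
Proof.
(* Sums start at index 1, so they are empty for [n = 0] and [n = 1]; orthogonality is available only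
   from index 1 on. *)
have S0 m : (m <= 1)%N -> Ex P (fun w => S m w ^+ 2) <=
    \sum_(1 <= t < m) Ex P (fun w => Num.min 1 (x t w ^+ 2)).
  move=> m1; rewrite big_geq// (_ : (fun w => _) = fun=> 0) ?Ex_cst//.
  by apply/funext => w; rewrite /S big_geq// expr0n.
elim: n => [|[_|n IH]]; [exact: S0|exact: S0|].
rewrite [leRHS]big_nat_recr//=.
pose s := fun w => sin (x n.+1 w).
have bs : bounded_mfun s by exact: bounded_mfun_sin.
rewrite (_ : (fun w => _) = fun w => S n.+1 w * S n.+1 w +
    (2 * (S n.+1 w * s w) + s w * s w)); last first.
  by apply/funext => w; rewrite /S big_nat_recr//= -/(s w); ring.
have b1 := bounded_mfunM (bS n.+1) (bS n.+1).
have b2 := bounded_mfunM (bS n.+1) bs.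
have b3 := bounded_mfunM bs bs.
rewrite ExD//; last by apply: bounded_mfunD => //; exact: bounded_mfunZ.
rewrite ExD//; last exact: bounded_mfunZ.
rewrite ExZ// Ex_sin_sum_orth// mulr0 add0r lerD//.
apply: le_Ex => // w; rewrite -expr2 le_min -sqr_normr.
rewrite expr_le1// sin_max /=.
rewrite -[leRHS]sqr_normr lerXn2r ?nnegrE//; exact: ler_norm_sin.
Qed.

(* Truncating with [sin] instead of an indicator keeps the summands centred
   without knowing that the [X t] have symmetric laws. *)
Lemma transform_tail n :
  Ex P (\1_[set w | 2 < `|\sum_(1 <= t < n) X t w * Z t w|]) <=
  3 * K * \sum_(1 <= t < n) Ex P (fun w => Num.min 1 (`|Z t w| `^ alpha)).
Proof.
pose q t w := Num.min 1 (x t w ^+ 2).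
have bQ : bounded_mfun (fun w => \sum_(1 <= t < n) q t w).
  by apply: bounded_mfun_sum => t _; exact: bq.
(* Pointwise, with [Q] the sum of the [q t]: if some [|x t w| >= 1] then [Q >= 1]. Otherwise the
   transform differs from [S n] by at most [Q], so [|S n| + Q > 2] and one of the two is at least 1.
   In mean, the square of [S n] costs one sum of the [Ex P (q t)] and [2 Q] costs two, whence the
   factor 3. *)
apply: (@le_trans _ _ (Ex P (fun w => S n w ^+ 2 + 2 * \sum_(1 <= t < n) q t w))).
  apply: le_Ex.
  - apply: bounded_mfun_indic; apply: measurable_set_lt.
    by apply: measurableT_comp => //; apply: measurable_bigsum => t _; exact: mx.
  - apply: bounded_mfunD; last exact: bounded_mfunZ.
    exact: bounded_mfunM (bS n) (bS n).
  - move=> w.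
    have q0 t : 0 <= q t w by rewrite le_min ler01 sqr_ge0.
    have Q0 : 0 <= \sum_(1 <= t < n) q t w by apply: sumr_ge0 => t _.
    have S20 := sqr_ge0 (S n w).
    rewrite indicE; case: (boolP (w \in _)) => [|_]; last first.
      by rewrite mulr0n addr_ge0// mulr_ge0.
    rewrite inE /= mulr1n => Sw.
    have [/existsP[[t tn] /=]/andP[t0 xt]|] :=
      boolP [exists t : 'I_n, (0 < t)%N && (1 <= `|x t w|)].
      have : q t w <= \sum_(1 <= t < n) q t w.
        rewrite (bigD1_seq t) ?iota_uniq ?mem_index_iota ?t0//= lerDl.
        by apply: sumr_ge0 => i _.
      have : q t w = 1.
        apply/min_idPl; rewrite -sqr_normr -[leLHS](expr1n _ 2).
        by rewrite lerXn2r ?nnegrE.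
      by move=> -> ?; nra.
    rewrite negb_exists => /forallP hx.
    have x1 t : (1 <= t < n)%N -> `|x t w| < 1.
      by move=> /andP[t1 tn]; have := hx (Ordinal tn); rewrite /= t1 /= -ltNge.
    have : `|\sum_(1 <= t < n) X t w * Z t w| <= `|S n w| + \sum_(1 <= t < n) q t w.
      rewrite (_ : \sum_(1 <= t < n) X t w * Z t w =
        S n w + \sum_(1 <= t < n) (x t w - sin (x t w))); last first.
        by rewrite sumrB /S addrC subrK.
      apply: (le_trans (ler_normD _ _)); rewrite lerD2l.
      apply: (le_trans (ler_norm_sum _ _ _)); rewrite big_nat [leRHS]big_nat.
      apply: ler_sum => t /x1/ltW tx; rewrite le_min sub_sin_le// andbT.
      apply: (le_trans (sub_sin_le tx)).
      by rewrite -sqr_normr expr_le1.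
    have : S n w ^+ 2 = `|S n w| ^+ 2 by rewrite sqr_normr.
    move: Sw; set Q := \sum_(1 <= t < n) q t w; move=> Sw -> h.
    have [?|?] := leP 1 `|S n w|; nra.
rewrite ExD//; [|exact: bounded_mfunM (bS n) (bS n)|exact: bounded_mfunZ].
rewrite ExZ// Ex_sum; last by move=> t _; exact: bq.
have := Ex_sin_sum_sqr n; rewrite -/q.
have : \sum_(1 <= t < n) Ex P (q t) <=
    K * \sum_(1 <= t < n) Ex P (fun w => Num.min 1 (`|Z t w| `^ alpha)).
  rewrite mulr_sumr big_nat [leRHS]big_nat; apply: ler_sum => t /andP[t0 _].
  exact: Ex_min1_sqr_transform.
by move=> h1 h2; rewrite -mulrA; lra.
Qed.

End MartingaleTransform.

(** * Tail bounds *)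

Section TailBounds.
Context {R : realType} {d : measure_display} {T : measurableType d}.
Variable P : probability T R.
Variables (alpha c : R).
Hypotheses (alpha0 : 0 < alpha) (c0 : 0 <= c).
Variable X : nat -> T -> R.
Hypothesis mX : forall t, measurable_fun setT (X t).
Hypothesis indepX : mutually_independent P X.
Hypothesis cfX : forall t u, (0 < t)%N ->
  Ex P (fun w => cos (u * X t w)) = expR (- (c * `|u| `^ alpha)).
Hypothesis sfX : forall t u, (0 < t)%N -> Ex P (fun w => sin (u * X t w)) = 0.

Local Notation K := (3 * (12 * c + 1)).

Let K0 : 0 < K.
Proof. by rewrite mulr_gt0// ltr_wpDl// mulr_ge0. Qed.

Let lt2_scale (y q : R) : 0 < y -> (2 < `|2 / y * q|) = (y < `|q|).
Proof.
move=> y0; rewrite normrM gtr0_norm ?divr_gt0// -mulrA ltr_pMr// mulrC.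
by rewrite ltr_pdivlMr// mul1r.
Qed.

(** Scaling by [2 / y] moves the threshold [y] to the 2 of [transform_tail]; since [|V t| <= 1], the
    mean of [min(1, |Z t|^alpha)] has a deterministic bound. The predictable factor [V] leaves room
    for stopping. *)
Lemma stopped_tail (b : nat -> R) (V : nat -> T -> R) (y : R) n : 0 < y ->
  (forall t, measurable_fun setT (V t : past_type X t -> R)) ->
  (forall t w, `|V t w| <= 1) ->
  Ex P (\1_[set w | y < `|\sum_(1 <= t < n) b t * X t w * V t w|]) <=
  K * (2 / y) `^ alpha * \sum_(1 <= t < n) `|b t| `^ alpha.
Proof.
move=> y0 pV V1.
have y20 : 0 < 2 / y by rewrite divr_gt0.
pose Z t w := 2 / y * b t * V t w.
have pZ t : measurable_fun setT (Z t : past_type X t -> R).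
  by apply: measurable_funM; [exact: measurable_cst|exact: pV].
have := transform_tail alpha0 c0 mX indepX cfX sfX pZ n.
rewrite (_ : [set w | 2 < _] = [set w | y < `|\sum_(1 <= t < n) b t * X t w * V t w|]).
  move=> /le_trans; apply.
  rewrite -[leRHS]mulrA ler_pM2l// mulr_sumr; apply: ler_sum => t _.
  rewrite -powRM ?(ltW y20)// -[leRHS](Ex_cst P); apply: le_Ex.
  - apply: bounded_mfun_min1 => [|w]; last exact: powR_ge0.
    apply: (measurableT_comp (measurable_powR _)).
    apply: measurableT_comp => //.
    exact: (past_measurable_fun mX (pZ t)).
  - exact: bounded_mfun_cst.
  - move=> w; rewrite ge_min; apply/orP; right.
    apply: ge0_ler_powR; rewrite ?nnegrE ?(ltW alpha0) ?mulr_ge0 ?invr_ge0 ?(ltW y0)//.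
    rewrite /Z normrM normrM (gtr0_norm y20).
    by rewrite ler_piMr// mulr_ge0// (ltW y20).
apply/seteqP; split => w /=;
  rewrite (_ : \sum_(1 <= t < n) X t w * Z t w =
      2 / y * \sum_(1 <= t < n) b t * X t w * V t w) ?lt2_scale//.
- by rewrite mulr_sumr; apply: eq_bigr => t _; rewrite /Z; ring.
- by rewrite mulr_sumr; apply: eq_bigr => t _; rewrite /Z; ring.
Qed.

Lemma linear_tail (b : nat -> R) (y : R) n : 0 < y ->
  Ex P (\1_[set w | y < `|\sum_(1 <= t < n) b t * X t w|]) <=
  K * (2 / y) `^ alpha * \sum_(1 <= t < n) `|b t| `^ alpha.
Proof.
move=> y0; have := @stopped_tail b (fun _ _ => 1) y n y0.
under eq_set => w do under eq_bigr => t _ do rewrite mulr1.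
apply; first by move=> t; exact: measurable_cst.
by move=> t w; rewrite normr1.
Qed.

Section Maximal.
Variable b : nat -> R.
Let S k w := \sum_(1 <= t < k) b t * X t w.

Let pS k t : (k <= t)%N -> measurable_fun setT (S k : past_type X t -> R).
Proof.
move=> kt; rewrite /S.
rewrite (_ : (fun w => _) = fun w => \sum_(1 <= t < k | (1 <= t < k)%N) b t * X t w); last first.
  by apply/funext => w; rewrite big_nat.
apply: measurable_bigsum => s /andP[_ sk].
apply: measurable_funM; first exact: measurable_cst.
exact: past_X_measurable (leq_trans sk kt).
Qed.

(* The indicator that no partial sum has exceeded [y] yet is predictable, so
   the stopped sum is again a martingale transform. *)
Lemma maximal_tail (y : R) n : 0 < y ->
  Ex P (\1_[set w | exists2 k, (k <= n)%N & y < `|\sum_(1 <= t < k) b t * X t w|]) <=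
  K * (2 / y) `^ alpha * \sum_(1 <= t < n) `|b t| `^ alpha.
Proof.
move=> y0.
pose A t : set T := \bigcap_(k in [set k | (k <= t)%N]) ~` [set w | y < `|S k w|].
have mSk k t : (k <= t)%N -> measurable ([set w | y < `|S k w|] : set (past_type X t)).
  move=> kt; apply: measurable_set_lt.
  by apply: measurableT_comp => //; exact: pS.
have mA t : measurable (A t : set (past_type X t)).
  apply: bigcap_measurable; first by exists 0%N.
  by move=> k kt; apply: measurableC; exact: mSk.
have mE : measurable [set w | exists2 k, (k <= n)%N & y < `|S k w|].
  rewrite (_ : [set w | _] = ~` A n).
    by apply: measurableC; exact: (past_measurable_set mX (mA n)).
  apply/seteqP; split => [w [k kn ykw] /(_ k kn)//|w /existsNP[k] /not_implyP[kn] /contrapT].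
  by exists k.
have mX' t : measurable_fun setT (\1_(A t) : T -> R).
  by apply: measurable_indic; exact: (past_measurable_set mX (mA t)).
apply: le_trans (@stopped_tail b (fun t => \1_(A t)) y n y0 _ _); last 2 first.
- by move=> t; exact: measurable_indic (mA t).
- by move=> t w; rewrite indicE; case: (_ \in _); rewrite ?normr1 ?normr0.
apply: le_Ex_indic => //.
  apply: measurable_set_lt; apply: measurableT_comp => //.
  apply: measurable_bigsum => t _; apply: measurable_funM => //.
  by apply: measurable_funM => //; exact: measurable_cst.
move=> w [k0 k0n yk0] /=.
have exk : exists k, y < `|S k w| by exists k0.
pose k := ex_minn exk.
have [yk kmin] : y < `|S k w| /\ forall j, y < `|S j w| -> (k <= j)%N.
  by rewrite /k; case: ex_minnP.
have kn : (k <= n)%N by apply: leq_trans (kmin _ yk0) k0n.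
have k1 : (1 <= k)%N.
  rewrite lt0n; apply/eqP => k00; move: yk; rewrite k00 /S big_geq// normr0.
  by rewrite ltNge ltW.
(* [k] is the first exceedance: [w] lies in [A t] exactly when [t < k], and [S k] sums the indices
   below [k], so the stopped sum equals [S k]. *)
rewrite (_ : \sum_(1 <= t < n) b t * X t w * \1_(A t) w = S k w)//.
rewrite (big_cat_nat k1 kn)/= [X in _ + X]big_nat [X in _ + X]big1 ?addr0.
  rewrite /S [LHS]big_nat [RHS]big_nat; apply: eq_bigr => t /andP[_ tk].
  rewrite indicE mem_set ?mulr1// => j /= jt /kmin kj.
  by have := leq_ltn_trans (leq_trans kj jt) tk; rewrite ltnn.
move=> t /andP[kt _]; rewrite indicE memNset ?mulr0// => At.
exact: (At k kt).
Qed.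

End Maximal.

(** Dyadic layer cake: [min(1, W)] is at most [2^-J] plus the sum over [j < J] of [2^-j] times the
    indicator of [W > 2^-(j+1)]. Each level costs [2^-j * B / 2^-(j+1) = 2 B], whatever [j]. *)
Lemma Ex_min1_weak_tail (W : T -> R) (B : R) (J : nat) :
  measurable_fun setT W -> (forall w, 0 <= W w) ->
  (forall v, 0 < v -> Ex P (\1_[set w | v < W w]) <= B / v) ->
  Ex P (fun w => Num.min 1 (W w)) <= 2^-1 ^+ J + 2 * B * J%:R.
Proof.
move=> mW W0 tail.
pose e j : R := 2^-1 ^+ j.
have e0 j : 0 < e j by rewrite exprn_gt0.
have be j : bounded_mfun (fun w => e j * \1_[set w | e j.+1 < W w] w).
  by apply: bounded_mfunZ; apply: bounded_mfun_indic; exact: measurable_set_lt.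
apply: (@le_trans _ _ (Ex P (fun w => e J +
    \sum_(j < J) e j * \1_[set w | e j.+1 < W w] w))).
  apply: le_Ex; first exact: bounded_mfun_min1.
    apply: bounded_mfunD; first exact: bounded_mfun_cst.
    exact: bounded_mfun_sum.
  move=> w; elim: J => [|J IH].
    by rewrite big_ord0 addr0 /e expr0 ge_min lexx.
  rewrite big_ord_recr /= indicE.
  have sum0 : 0 <= \sum_(i < J) e i * \1_[set w0 | e i.+1 < W w0] w.
    apply: sumr_ge0 => i _; apply: mulr_ge0; first exact: ltW.
    by rewrite indicE ler0n.
  have [h|h] := boolP (w \in [set w0 | e J.+1 < W w0]).
    rewrite mulr1; apply: (le_trans IH).
    by have := e0 J.+1; lra.
  rewrite mulr0 addr0 ge_min; apply/orP; right.
  move: h; rewrite notin_setE /= => /negP; rewrite -leNgt => /le_trans; apply.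
  by rewrite lerDl.
rewrite ExD; [|exact: bounded_mfun_cst|exact: bounded_mfun_sum].
rewrite Ex_cst lerD2l Ex_sum//.
apply: (@le_trans _ _ (\sum_(j < J) 2 * B)).
  apply: ler_sum => j _; rewrite ExZ; last first.
    by apply: bounded_mfun_indic; exact: measurable_set_lt.
  have -> : 2 * B = e j * (B / e j.+1).
    rewrite mulrCA mulrC; congr (_ * _).
    by rewrite /e exprS invfM invrK mulrCA mulfV ?mulr1// gt_eqF// e0.
  by rewrite ler_pM2l// tail.
by rewrite sumr_const card_ord mulr_natr.
Qed.

(** The inner linear forms all obey the same weak tail, because reversing the order of summation
    leaves their coefficient sum a partial sum of [|b k|^alpha]. The number [J] of dyadic levels
    stays free, to be matched to [n] later. *)
Lemma quadratic_tail (b : nat -> R) (B y : R) n J : 0 < y ->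
  (forall t, \sum_(1 <= k < t) `|b k| `^ alpha <= B) ->
  Ex P (\1_[set w | y < `|\sum_(1 <= t < n)
     X t w * \sum_(1 <= s < t) b (t - s)%N * X s w|]) <=
  K * n%:R * (2^-1 ^+ J + 2 * (K * (4 / y) `^ alpha * B) * J%:R).
Proof.
move=> y0 bB.
have y20 : 0 < 2 / y by rewrite divr_gt0.
pose Z t w := 2 / y * \sum_(1 <= s < t) b (t - s)%N * X s w.
have pZ t : measurable_fun setT (Z t : past_type X t -> R).
  apply: measurable_funM; first exact: measurable_cst.
  rewrite (_ : (fun w => _) = fun w => \sum_(1 <= s < t | (1 <= s < t)%N) b (t - s)%N * X s w); last first.
    by apply/funext => w; rewrite big_nat.
  apply: measurable_bigsum => s /andP[_ st].
  by apply: measurable_funM; [exact: measurable_cst|exact: past_X_measurable].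
have mZ t := past_measurable_fun mX (pZ t).
have := transform_tail alpha0 c0 mX indepX cfX sfX pZ n.
rewrite (_ : [set w | 2 < _] = [set w | y < `|\sum_(1 <= t < n)
     X t w * \sum_(1 <= s < t) b (t - s)%N * X s w|]); last first.
  apply/seteqP; split => w /=;
  rewrite (_ : \sum_(1 <= t < n) X t w * Z t w =
      2 / y * \sum_(1 <= t < n) X t w * \sum_(1 <= s < t) b (t - s)%N * X s w)
      ?lt2_scale//.
  - by rewrite mulr_sumr; apply: eq_bigr => t _; rewrite /Z; ring.
  - by rewrite mulr_sumr; apply: eq_bigr => t _; rewrite /Z; ring.
move=> /le_trans; apply; rewrite -[leRHS]mulrA ler_pM2l//.
set L := _ + _.
have L0 : 0 <= L.
  have B0 : 0 <= B by rewrite (le_trans _ (bB 0%N))// big_geq.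
  apply: addr_ge0; first exact: exprn_ge0.
  do 3! apply: mulr_ge0 => //.
  by apply: mulr_ge0; [exact: ltW|exact: powR_ge0].
apply: (@le_trans _ _ (\sum_(1 <= t < n) L)); last first.
  rewrite big_const_nat iter_addr addr0 [leRHS]mulr_natl.
  by apply: ler_wpMn2l => //; exact: leq_subr.
apply: ler_sum => t _; apply: Ex_min1_weak_tail.
- apply: (measurableT_comp (measurable_powR _)).
  exact: measurableT_comp.
- by move=> w; exact: powR_ge0.
- move=> v v0.
  (* Solves [(2 / y * y')^alpha = v]: the event [|Z t|^alpha > v] says that the inner linear form
     exceeds [y']. Then [2 / y' = 4 / y * v^(-1/alpha)], the origin of the 4 in the bound. *)
  pose y' := y / 2 * v `^ alpha^-1.
  have y'0 : 0 < y' by rewrite mulr_gt0 ?divr_gt0// powR_gt0.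
  have := @linear_tail (fun s => b (t - s)%N) y' t y'0.
  rewrite (_ : [set w | y' < _] = [set w | v < `|Z t w| `^ alpha]); last first.
    have E w : (v < `|Z t w| `^ alpha) = (y' < `|\sum_(1 <= s < t) b (t - s)%N * X s w|).
      rewrite /Z normrM (gtr0_norm y20).
      set q := `|_|; have q0 : 0 <= q by exact: normr_ge0.
      have {1}-> : v = (v `^ alpha^-1) `^ alpha.
        by rewrite -powRrM mulVf ?gt_eqF// powRr1// ltW.
      apply/idP/idP => h.
        have : v `^ alpha^-1 < 2 / y * q.
          rewrite ltNge; apply/negP => h'.
          move: h; rewrite ltNge => /negP; apply.
          by apply: ge0_ler_powR; rewrite ?nnegrE ?(ltW alpha0) ?powR_ge0 ?mulr_ge0 ?invr_ge0 ?(ltW y0).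
        rewrite /y' => h'; rewrite mulrC -ltr_pdivlMr ?divr_gt0//.
        by rewrite invf_div mulrC.
      apply: gt0_ltr_powR; rewrite ?nnegrE ?powR_ge0 ?mulr_ge0 ?invr_ge0 ?(ltW y0)//.
      by move: h; rewrite /y' mulrC -ltr_pdivlMr ?divr_gt0// invf_div mulrC.
    by apply/seteqP; split => w /=; rewrite E.
  move=> /le_trans; apply.
  have -> : (2 / y') `^ alpha = (4 / y) `^ alpha / v.
    rewrite /y' (_ : 2 / _ = 4 / y * (v `^ alpha^-1)^-1); last first.
      by field; rewrite !gt_eqF//= powR_gt0.
    rewrite powRM ?invr_ge0 ?powR_ge0 ?divr_ge0 ?(ltW y0)//; congr (_ * _).
    by rewrite -powRN -powRrM mulNr mulVf ?gt_eqF// powR_inv1// ltW.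
  have -> : \sum_(1 <= s < t) `|b (t - s)%N| `^ alpha = \sum_(1 <= k < t) `|b k| `^ alpha.
    rewrite big_nat_rev /= [LHS]big_nat [RHS]big_nat; apply: eq_bigr => i /andP[i1 it].
    by rewrite add1n subSS subKn// ltnW.
  rewrite [leRHS]mulrAC [X in X * _ <= _]mulrA; apply: ler_wpM2l => //.
  apply: divr_ge0; last exact: ltW.
  by apply: mulr_ge0; [exact: ltW|exact: powR_ge0].
Qed.

End TailBounds.

(** * Random series *)

Section RandomSeries.
Context {R : realType}.

(** Every block sum is a difference of two partial sums, and from some index on these lie within [e]
    of their supremum. *)
Lemma summable_tail (f : nat -> R) (e : R) : (forall k, 0 <= f k) ->
  (\sum_(1 <= k <oo) (f k)%:E < +oo)%E -> 0 < e ->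
  exists m0, forall m n, (m0 <= m)%N -> \sum_(m <= k < n) f k <= e.
Proof.
move=> f0 foo e0.
pose u n := \sum_(1 <= k < n) f k.
have f0' n : (1 <= n)%N -> true -> (0 <= (f n)%:E)%E by rewrite lee_fin.
have uub n : u n <= fine (\sum_(1 <= k <oo) (f k)%:E)%E.
  rewrite -lee_fin fineK ?ge0_fin_numE//; last exact: nneseries_ge0.
  by rewrite /u -sumEFin; apply: nneseries_lim_ge => k *; exact: f0'.
have supu : has_sup (range u).
  split; first by exists (u 0%N); exists 0%N.
  by exists (fine (\sum_(1 <= k <oo) (f k)%:E)%E) => _ [n _ <-].
have [_ [m0 _ <-] um0] := sup_adherent e0 supu.
exists m0.+1 => m n mm0.
have [nm|mn] := leqP n m; first by rewrite big_geq// ltW.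
have m1 : (1 <= m)%N by exact: leq_ltn_trans mm0.
have -> : \sum_(m <= k < n) f k = u n - u m.
  by rewrite /u (big_cat_nat m1 (ltnW mn))/= addrAC subrr add0r.
have um : u m0 <= u m.
  have [m01|m01] := leqP 1 m0; last first.
    by rewrite {1}/u big_geq ?(ltnW m01)//; apply: sumr_ge0.
  by rewrite /u (big_cat_nat m01 (ltnW mm0))/= lerDl; apply: sumr_ge0.
have un : u n <= sup (range u) by apply: (ub_le_sup supu.2); exists n.
by apply: ltW; rewrite ltrBlDr; apply: le_lt_trans un _; rewrite -ltrBlDl; apply: lt_le_trans um0 _.
Qed.

Context {d : measure_display} {T : measurableType d}.
Variable P : probability T R.
Variables (alpha c : R).
Hypotheses (alpha0 : 0 < alpha) (c0 : 0 <= c).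
Variable X : nat -> T -> R.
Hypothesis mX : forall t, measurable_fun setT (X t).
Hypothesis indepX : mutually_independent P X.
Hypothesis cfX : forall t u, (0 < t)%N ->
  Ex P (fun w => cos (u * X t w)) = expR (- (c * `|u| `^ alpha)).
Hypothesis sfX : forall t u, (0 < t)%N -> Ex P (fun w => sin (u * X t w)) = 0.

Local Notation K := (3 * (12 * c + 1)).

Variable a : nat -> R.
Let S n w := \sum_(1 <= k < n) a k * X k w.

Let mS n : measurable_fun setT (S n).
Proof.
by apply: measurable_bigsum => k _; apply: measurable_funM.
Qed.

(** With [divergent], this writes the failure of the Cauchy criterion by countable unions and
    intersections, which gives measurability. *)
Let osc p m : set T := \bigcup_k [set w | p.+1%:R^-1 < `|S (m + k) w - S m w|].

Let mosc1 p m k : measurable [set w | p.+1%:R^-1 < `|S (m + k) w - S m w|].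
Proof.
apply: measurable_set_lt; apply: measurableT_comp => //.
exact: measurable_funB.
Qed.

Let mosc p m : measurable (osc p m).
Proof. exact: bigcupT_measurable. Qed.

Let divergent : set T := \bigcup_p \bigcap_m osc p m.

Let mdivergent : measurable divergent.
Proof. by apply: bigcupT_measurable => p; exact: bigcapT_measurable. Qed.

Let cvg_S w : ~ divergent w -> cvgn (S ^~ w).
Proof.
move=> ndiv; apply/cauchy_cvgP/cauchy_exP => e e0.
have [p _ pe] : \forall p \near \oo, p.+1%:R^-1 < e :> R.
  by have := @near_infty_natSinv_lt R (PosNum e0).
have [m Hm] : exists m, ~ osc p m w.
  by apply: contrapT => /forallNP h; apply: ndiv; exists p => // m _; apply: contrapT; exact: h.
exists (S m w); exists m => // n /= mn.
rewrite /ball /= -normrN opprB; apply: le_lt_trans (pe p (leqnn _)).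
rewrite leNgt; apply/negP => h; apply: Hm; exists (n - m)%N => //=.
by rewrite subnKC.
Qed.

Let dvg_S w : divergent w -> ~ cvgn (S ^~ w).
Proof.
move=> [p _ hp] /cvg_ex[l /cvgrPdist_lt /(_ (p.+1%:R^-1 / 2))] [].
  by rewrite divr_gt0.
move=> m _ hm; have [k _ /=] := hp m I.
have := hm m (leqnn m); have := hm (m + k)%N (leq_addr _ _) => /= h1 h2.
apply/negP; rewrite -leNgt -(subrKA l) (le_trans (ler_normD _ _))//.
rewrite [leRHS](splitr p.+1%:R^-1) distrC.
by apply: lerD; exact: ltW.
Qed.

(** [limn] takes the default value 0 where the partial sums diverge, so [Ya] is everywhere the limit
    of the partial sums times the indicator of the convergence set. *)
Lemma measurable_Ya : measurable_fun setT (Ya X a).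
Proof.
apply: (@measurable_fun_cvg _ _ _ _ (fun n w => S n w * \1_(~` divergent) w)).
  move=> n; apply: measurable_funM => //.
  by apply: measurable_indic; exact: measurableC.
move=> w _; rewrite /Ya; have [dw|dw] := pselect (divergent w).
  rewrite (_ : limn _ = 0).
    apply: cvg_near_cst; apply: nearW => n.
    by rewrite indicE memNset ?mulr0// => /(_ dw).
  exact: (dvgP (dvg_S dw)).
under eq_fun do rewrite indicE mem_set ?mulr1//.
exact: cvg_S.
Qed.

Hypothesis suma : (\sum_(1 <= k <oo) (`|a k| `^ alpha)%:E < +oo)%E.

(** The maximal inequality for the coefficients [a] set to 0 below [m]: their partial sums are the
    increments [S k - S m]. *)
Let Ex_osc p m n (e : R) : (1 <= m)%N ->
  (forall n, \sum_(m <= k < n) `|a k| `^ alpha <= e) ->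
  (P (\big[setU/set0]_(k < n)
    [set w | (p.+1%:R^-1 < `|S (m + k)%N w - S m w|)%R]) <=
  (K * (2 * p.+1%:R) `^ alpha * e)%:E)%E.
Proof.
move=> m1 tail.
have K0 : 0 < K by rewrite mulr_gt0// ltr_wpDl// mulr_ge0.
pose b k := if (k < m)%N then 0 else a k.
have p0 : 0 < p.+1%:R^-1 :> R by [].
have bS k w : (m <= k)%N -> \sum_(1 <= t < k) b t * X t w = S k w - S m w.
  move=> mk; rewrite /S (big_cat_nat m1 mk)/= [X in _ = X - _](big_cat_nat m1 mk)/=.
  rewrite [in RHS]addrAC subrr add0r big_nat big1 ?add0r.
    rewrite big_nat [RHS]big_nat; apply: eq_bigr => t /andP[mt _].
    by rewrite /b ltnNge mt.
  by move=> t /andP[_ tm]; rewrite /b tm mul0r.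
have := maximal_tail alpha0 c0 mX indepX cfX sfX b (m + n) p0.
rewrite invrK => h.
set E := \big[_/_]_(k < n) _.
have mE : measurable E by apply: bigsetU_measurable.
rewrite -(Ex_indic P mE) lee_fin.
apply: (@le_trans _ _ (K * (2 * p.+1%:R) `^ alpha *
    \sum_(1 <= t < m + n) `|b t| `^ alpha)); last first.
  apply: ler_wpM2l; first by apply: mulr_ge0; [exact: ltW|exact: powR_ge0].
  rewrite (big_cat_nat m1 (leq_addr _ _))/= big_nat big1 ?add0r.
    apply: le_trans (tail (m + n)%N); rewrite big_nat [leRHS]big_nat.
    by apply: ler_sum => t /andP[mt _]; rewrite /b ltnNge mt.
  by move=> t /andP[_ tm]; rewrite /b tm normr0 powR0// gt_eqF.
apply: le_trans h; apply: le_Ex_indic => //.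
  pose G k := [set w | p.+1%:R^-1 < `|\sum_(1 <= t < k) b t * X t w|].
  rewrite (_ : [set w | _] = \big[setU/set0]_(k < (m + n).+1) G k).
    apply: bigsetU_measurable => k _; apply: measurable_set_lt.
    apply: measurableT_comp => //; apply: measurable_bigsum => t _.
    by apply: measurable_funM => //; exact: measurable_cst.
  rewrite -bigcup_mkord; apply/seteqP; split => w [k /= kn h]; exists k => //.
rewrite /E -(bigcup_mkord n (fun k =>
  [set w | p.+1%:R^-1 < `|S (m + k) w - S m w|])) => w [k /= kn hk]; exists (m + k)%N.
  by rewrite leq_add2l ltnW.
by rewrite bS// leq_addr.
Qed.

(** For fixed [p] it suffices to make [P (osc p m)] small for one [m]. That event is an increasing
    union of finite maxima, all bounded by the same tail of the series of [|a k|^alpha]. *)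
Lemma negligible_divergent : P divergent = 0%E.
Proof.
apply/(negligibleP _ mdivergent); apply: negligible_bigcup => p.
have mI : measurable (\bigcap_m osc p m) by exact: bigcapT_measurable.
apply/(negligibleP _ mI)/eqP; rewrite -measure_le0; apply/lee_addgt0Pr => e e0.
rewrite add0e.
pose C := K * (2 * p.+1%:R) `^ alpha.
have C0 : 0 <= C.
  by apply: mulr_ge0; [rewrite mulr_ge0// addr_ge0// mulr_ge0|exact: powR_ge0].
have C1 : 0 < C + 1 by exact: ltr_wpDl.
have [m0 tail] := summable_tail (fun k => powR_ge0 _ _) suma (divr_gt0 e0 C1).
pose F0 k := [set w | p.+1%:R^-1 < `|S (m0.+1 + k) w - S m0.+1 w|].
pose F n := \big[setU/set0]_(k < n.+1) F0 k.
have mF n : measurable (F n).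
  by apply: bigsetU_measurable => k _; exact: mosc1.
have oscE : osc p m0.+1 = \bigcup_n F n by rewrite [RHS]bigcup_bigsetU_bigcup.
apply: (@le_trans _ _ (P (osc p m0.+1))).
  by apply: le_measure; rewrite ?inE//; exact: bigcap_inf.
rewrite oscE.
have cvF : P \o F @ \oo --> P (\bigcup_n F n).
  apply: nondecreasing_cvg_mu => //; first exact: bigcupT_measurable.
  by move=> i j ij; apply/subsetPset; exact: subset_bigsetU.
apply: (cvge_to_le cvF); apply: nearW => n /=.
have := @Ex_osc p m0.+1 n.+1 (e / (C + 1)) isT (fun n' => tail m0.+1 n' (leqnSn _)).
move=> /le_trans; apply; rewrite lee_fin -/C mulrCA ger_pMr//.
by rewrite ler_pdivrMr// mul1r lerDl.
Qed.

Lemma cvg_Ya_ae : {ae P, forall w,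
  (fun n => \sum_(1 <= k < n) a k * X k w) @ \oo --> Ya X a w}.
Proof.
exists divergent; split => //; first exact: negligible_divergent.
by move=> w /= nc; apply: contrapT => /cvg_S.
Qed.

End RandomSeries.

(** * Convergence in distribution of row vectors *)

Section ConvergenceInDistribution.
Context {R : realType}.

(** * Measurability of continuous functionals of a random row vector *)

Section Measurability.
Context {d : measure_display} {T : measurableType d} {r : nat}.
Variable V : T -> 'rV[R]_r.
Hypothesis mV : forall i, measurable_fun setT (fun w => V w ord0 i).

(** The norm is the supremum norm, so balls are boxes and pull back to measurable sets; an open set
    is the countable union of the balls inside it with rational centre and radius [1/(k+1)]. *)
Lemma measurable_rV_open (O : set 'rV[R]_r) : open O -> measurable (V @^-1` O).
Proof.
move=> oO.
pose A (qk : 'rV[rat]_r * nat) : set T :=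
  if `[< ball (map_mx ratr qk.1 : 'rV[R]_r) qk.2.+1%:R^-1 `<=` O >] then
    \bigcap_(i in [set: 'I_r]) [set w | `|ratr (qk.1 ord0 i) - V w ord0 i| < qk.2.+1%:R^-1]
  else set0.
have mA qk : measurable (A qk).
  rewrite /A; case: ifP => // _.
  apply: fin_bigcap_measurable => // i _.
  have mf : measurable_fun setT (fun w => `|ratr (qk.1 ord0 i) - V w ord0 i|).
    by apply: measurableT_comp => //; apply: measurable_funB.
  have := mf measurableT `]-oo, qk.2.+1%:R^-1[%classic (measurable_itv _).
  by rewrite setTI; congr (measurable _); apply/seteqP; split => w /=; rewrite in_itv.
rewrite (_ : V @^-1` O = \bigcup_n (if unpickle n is Some qk then A qk else set0)).
  by apply: bigcupT_measurable => n; case: unpickle.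
apply/seteqP; split => [w Ow|w [n _]]; last first.
  case: unpickle => // -[q k]; rewrite /A /=; case: asboolP => //= sub h.
  apply: sub; rewrite /ball /= /mx_ball; split => // i j; rewrite ord1 mxE.
  exact: h.
have /nbhs_ballP[e /= e0 eO] : nbhs (V w) O by apply: open_nbhs_nbhs.
have e20 : 0 < e / 2 by rewrite divr_gt0.
(* A ball of radius below [e / 2] that contains [V w] lies inside the ball of radius [e] around
   [V w]. *)
have [k _ /(_ k (leqnn k)) /= ke] := @near_infty_natSinv_lt R (PosNum e20).
have k0 : 0 < k.+1%:R^-1 :> R by [].
have hq i : exists q : rat, `|ratr q - V w ord0 i| < k.+1%:R^-1.
  have /rat_in_itvoo[q] : V w ord0 i - k.+1%:R^-1 < V w ord0 i + k.+1%:R^-1.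
    by rewrite ltrD2l; apply: lt_trans k0; rewrite oppr_lt0.
  rewrite in_itv /= => /andP[h1 h2]; exists q.
  by rewrite ltr_distl h1 h2.
have [q qP] := choice hq.
exists (pickle (\row_i q i, k)) => //; rewrite pickleK /A /=; case: asboolP => [_|[]].
  by move=> i _ /=; rewrite mxE.
move=> y [_ ky]; apply: eO; split => // i j; rewrite /ball /= (ord1 i).
have := ky ord0 j; rewrite /ball /= !mxE => h.
rewrite -(subrKA (ratr (q j))) (le_lt_trans (ler_normD _ _))// (splitr e) ltrD//.
  by rewrite distrC (lt_trans (qP j)).
exact: lt_trans h ke.
Qed.

Lemma measurable_continuous_rV (f : 'rV[R]_r -> R) : continuous f ->
  measurable_fun setT (fun w => f (V w)).
Proof.
move=> /continuousP cf.
apply: (measurability _ (RGenOInfty.measurableE R)).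
move=> _ [_ [x ->] <-]; rewrite setTI.
apply: (@measurable_rV_open (f @^-1` `]x, +oo[%classic)).
by apply: cf; exact: (@interval_open R (BRight x) +oo%O).
Qed.

Lemma bounded_mfun_continuous_rV (f : 'rV[R]_r -> R) : continuous f ->
  (exists M : R, forall x, `|f x| <= M) -> bounded_mfun (fun w => f (V w)).
Proof.
move=> cf [M hM]; split; first exact: measurable_continuous_rV.
by exists M => w.
Qed.

End Measurability.

Lemma norm_rV_le (r : nat) (x : 'rV[R]_r) (e : R) : 0 <= e ->
  (forall i, `|x ord0 i| <= e) -> `|x| <= e.
Proof.
move=> e0 h; rewrite -[`|x|]/(mx_norm x) mx_normrE; apply: bigmax_le => // -[i j] _ /=.
by rewrite (ord1 i).
Qed.

Lemma continuous_rVP (r : nat) (f : 'rV[R]_r -> R) (x : 'rV[R]_r) :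
  {for x, continuous f} <-> forall e, 0 < e ->
    exists2 dl, 0 < dl & forall y, `|x - y| < dl -> `|f x - f y| <= e.
Proof.
have cvgP := @cvgrPdist_le _ _ _ _ (nbhs_filter x) f (f x).
split => [/cvgP cf e /cf /nbhs_ballP[dl dl0 h]|h].
  by exists dl => // y xy; apply: h; rewrite mx_norm_ball.
apply/cvgP => e /h [dl dl0 hd]; apply/nbhs_ballP; exists dl => // y.
by rewrite mx_norm_ball => /hd.
Qed.

Definition lipschitz_fun (r : nat) (L : R) (g : 'rV[R]_r -> R) : Prop :=
  forall x y, `|g x - g y| <= L * `|x - y|.

Lemma lipschitz_continuous (r : nat) (L : R) (g : 'rV[R]_r -> R) : 0 <= L ->
  lipschitz_fun L g -> continuous g.
Proof.
move=> L0 Lg x; apply/continuous_rVP => e e0.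
have L1 : 0 < L + 1 by rewrite ltr_wpDl.
exists (e / (L + 1)) => [|y]; first exact: divr_gt0.
rewrite ltr_pdivlMr// => /ltW h.
apply: (le_trans (Lg x y)); apply: le_trans h; rewrite mulrC ler_wpM2l//.
by rewrite lerDl.
Qed.

Section LipschitzMinorant.
Context {r : nat}.
Variables (f : 'rV[R]_r -> R) (M : R).
Hypothesis fM : forall x, `|f x| <= M.

(** The Pasch-Hausdorff envelope of [f]: its largest minorant with Lipschitz constant [k]. *)
Definition lip_minorant (k : nat) (x : 'rV[R]_r) : R :=
  inf [set f y + k%:R * `|x - y| | y in setT].

Let has_inf_minorant k x : has_inf [set f y + k%:R * `|x - y| | y in setT].
Proof.
split; first by exists (f 0 + k%:R * `|x - 0|); exists 0.
exists (- M) => _ [y _ <-]; apply: le_trans (_ : f y <= _).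
  by have := fM y; rewrite ler_norml => /andP[].
by rewrite lerDl mulr_ge0.
Qed.

Lemma lip_minorant_le k x y : lip_minorant k x <= f y + k%:R * `|x - y|.
Proof. by apply: (ge_inf (has_inf_minorant k x).2); exists y. Qed.

Lemma le_lip_minorant k x z : (forall y, z <= f y + k%:R * `|x - y|) ->
  z <= lip_minorant k x.
Proof.
move=> h; apply: lb_le_inf; first exact: (has_inf_minorant k x).1.
by move=> _ [y _ <-].
Qed.

Lemma lip_minorant_le_fun k x : lip_minorant k x <= f x.
Proof. by have := lip_minorant_le k x x; rewrite subrr normr0 mulr0 addr0. Qed.

Lemma lip_minorant_bound k x : `|lip_minorant k x| <= M.
Proof.
rewrite ler_norml; apply/andP; split.
  apply: le_lip_minorant => y; apply: le_trans (_ : f y <= _).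
    by have := fM y; rewrite ler_norml => /andP[].
  by rewrite lerDl mulr_ge0.
by apply: (le_trans (lip_minorant_le_fun k x)); have := fM x; rewrite ler_norml => /andP[].
Qed.

Lemma lip_minorant_lipschitz k : lipschitz_fun k%:R (lip_minorant k).
Proof.
have half x y : lip_minorant k x - k%:R * `|x - y| <= lip_minorant k y.
  apply: le_lip_minorant => z; rewrite lerBlDr.
  apply: (le_trans (lip_minorant_le k x z)); rewrite -addrA lerD2l -mulrDr.
  rewrite ler_wpM2l// [leRHS]addrC (le_trans _ (ler_normD _ _))//.
  by rewrite subrKA.
move=> x y; rewrite ler_distl; apply/andP; split.
  by rewrite distrC; exact: half.
by rewrite -lerBlDr; exact: half.
Qed.

Lemma cvg_lip_minorant x : {for x, continuous f} ->
  (fun k => lip_minorant k x) @ \oo --> f x.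
Proof.
move=> cf; apply/cvgrPdist_le => e e0.
have [dl dl0 hdl] := (continuous_rVP f x).1 cf e e0.
near=> k.
rewrite ger0_norm ?subr_ge0 ?lip_minorant_le_fun// lerBlDr -lerBlDl.
apply: le_lip_minorant => y.
(* Near [x] continuity bounds the loss by [e]; far from [x] the penalty [k |x - y|] exceeds [2 M],
   the largest possible oscillation of [f]. *)
have [h|h] := ltP `|x - y| dl.
  have : `|f x - f y| <= e by exact: hdl.
  rewrite ler_norml => /andP[_]; rewrite lerBlDr => fxy.
  by rewrite lerBlDl (le_trans fxy)// lerD2l lerDl mulr_ge0.
have kM : 2 * M / dl <= k%:R.
  by near: k; exact: nbhs_infty_ger.
have : 2 * M <= k%:R * `|x - y|.
  rewrite -(divfK (lt0r_neq0 dl0) (2 * M)); apply: ler_pM => //; last exact: ltW.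
  apply: divr_ge0; last exact: ltW.
  by apply: mulr_ge0 => //; exact: le_trans (fM x).
have := fM x; have := fM y; rewrite !ler_norml => /andP[? ?] /andP[? ?].
lra.
Unshelve. all: by end_near. Qed.

End LipschitzMinorant.

(** * From bounded Lipschitz to bounded continuous test functions *)

Section Portmanteau.
Context {d d' : measure_display} {T : measurableType d} {T' : measurableType d'}.
Context {r : nat}.
Variables (P : probability T R) (Q : probability T' R).
Variables (V : nat -> T -> 'rV[R]_r) (W : T' -> 'rV[R]_r).
Hypothesis mV : forall n i, measurable_fun setT (fun w => V n w ord0 i).
Hypothesis mW : forall i, measurable_fun setT (fun w => W w ord0 i).

Hypothesis cvg_lip : forall (g : 'rV[R]_r -> R) (L M : R), 0 <= L ->
  lipschitz_fun L g -> (forall x, `|g x| <= M) ->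
  Ex P (fun w => g (V n w)) @[n --> \oo] --> Ex Q (fun w => g (W w)).

(** A Lipschitz minorant of [f] with nearly the same mean under the limit law passes the lower bound
    on. The upper bound is this one applied to [- f]. *)
Let eventually_lower (f : 'rV[R]_r -> R) (M e : R) : continuous f ->
  (forall x, `|f x| <= M) -> 0 < e ->
  \forall n \near \oo, Ex Q (fun w => f (W w)) - e <= Ex P (fun w => f (V n w)).
Proof.
move=> cf fM e0; have e20 : 0 < e / 2 by rewrite divr_gt0.
have Lk k := lip_minorant_lipschitz fM k.
have ck k := lipschitz_continuous (ler0n R k) (Lk k).
have Bk k := lip_minorant_bound fM k.
have : Ex Q (fun w => lip_minorant f k (W w)) @[k --> \oo] --> Ex Q (fun w => f (W w)).
  apply: (dominated_cvg_Ex (M := M)).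
  - by move=> k; exact: measurable_continuous_rV.
  - exact: measurable_continuous_rV.
  - by move=> k x.
  - by apply: aeW => w; apply: (cvg_lip_minorant fM); exact: cf.
move=> /cvgrPdist_le /(_ _ e20) [k _ /(_ k (leqnn k))] /= hk.
have := cvg_lip (ler0n R k) (Lk k) (Bk k).
move=> /cvgrPdist_le /(_ _ e20); apply: filterS => n hn.
apply: (@le_trans _ _ (Ex P (fun w => lip_minorant f k (V n w)))).
  move: hk hn; rewrite !ler_norml => /andP[_ h1] /andP[_ h2]; lra.
apply: le_Ex; first by apply: bounded_mfun_continuous_rV => //; exists M; exact: Bk.
  by apply: bounded_mfun_continuous_rV => //; exists M.
by move=> w; exact: (lip_minorant_le_fun fM).
Qed.

Lemma cvg_in_distribution_lipschitz : cvg_in_distribution P V Q W.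
Proof.
move=> f cf [M fM]; apply/cvgrPdist_le => e e0.
have cNf : continuous (fun x => - f x).
  move=> x; apply/continuous_rVP => e' /((continuous_rVP f x).1 (cf x))[dl dl0 h].
  by exists dl => // y /h; rewrite -opprD normrN.
have fNM x : `|- f x| <= M by rewrite normrN.
have ExN d0 (T0 : measurableType d0) (P0 : probability T0 R) (U : T0 -> 'rV[R]_r) :
    (forall i, measurable_fun setT (fun w => U w ord0 i)) ->
    Ex P0 (fun w => - f (U w)) = - Ex P0 (fun w => f (U w)).
  move=> mU; rewrite -mulN1r -ExZ; last by apply: bounded_mfun_continuous_rV => //; exists M.
  by congr (Ex _ _); apply/funext => w; rewrite mulN1r.
have := eventually_lower cNf fNM e0; have := eventually_lower cf fM e0.
apply: filterS2 => n h1; rewrite !ExN// => h2.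
by rewrite ler_norml; apply/andP; split; lra.
Qed.

End Portmanteau.

Section ConvergingTogether.
Context {d d' : measure_display} {T : measurableType d} {T' : measurableType d'}.
Context {r : nat}.
Variables (P : probability T R) (Q : probability T' R).
Variables (V : nat -> T -> 'rV[R]_r) (W : T' -> 'rV[R]_r).
Variables (Vm : nat -> nat -> T -> 'rV[R]_r) (Wm : nat -> T' -> 'rV[R]_r).
Hypothesis mV : forall n i, measurable_fun setT (fun w => V n w ord0 i).
Hypothesis mW : forall i, measurable_fun setT (fun w => W w ord0 i).
Hypothesis mVm : forall m n i, measurable_fun setT (fun w => Vm m n w ord0 i).
Hypothesis mWm : forall m i, measurable_fun setT (fun w => Wm m w ord0 i).
Hypothesis cvg_m : forall m, cvg_in_distribution P (Vm m) Q (Wm m).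
Hypothesis cvg_W : {ae Q, forall w, forall i, Wm m w ord0 i @[m --> \oo] --> W w ord0 i}.
Hypothesis close : forall (i : 'I_r) (dl e : R), 0 < dl -> 0 < e ->
  \forall m \near \oo, \forall n \near \oo,
    Ex P (\1_[set w | dl < `|V n w ord0 i - Vm m n w ord0 i|]) <= e.

(** The level [m] is fixed before [n] grows, as in the quantifiers of [close]. A Lipschitz test
    function changes by at most [L dl] when all coordinates are [dl]-close, and by at most [2 M] on
    the exceptional event. *)
Lemma converging_together : cvg_in_distribution P V Q W.
Proof.
apply: cvg_in_distribution_lipschitz => // g L M L0 Lg gM.
have cg := lipschitz_continuous L0 Lg.
have M0 : 0 <= M by apply: le_trans (gM 0).
have bg d0 (T0 : measurableType d0) (U : T0 -> 'rV[R]_r) :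
    (forall i, measurable_fun setT (fun w => U w ord0 i)) ->
    bounded_mfun (fun w => g (U w)).
  by move=> mU; apply: bounded_mfun_continuous_rV => //; exists M.
have cvW : Ex Q (fun w => g (Wm m w)) @[m --> \oo] --> Ex Q (fun w => g (W w)).
  apply: (dominated_cvg_Ex (M := M)).
  - by move=> m; case: (bg _ _ (Wm m) (mWm m)).
  - by case: (bg _ _ W mW).
  - by move=> m w.
  - apply: filterS cvg_W => w cw.
    apply: continuous_cvg; first exact: cg.
    apply/cvgrPdist_le => e e0.
    have : \forall m \near \oo, forall i : 'I_r, `|W w ord0 i - Wm m w ord0 i| <= e.
      apply: filter_forall => i; move: (cw i) => /cvgrPdist_le; exact.
    apply: filterS => m h; apply: norm_rV_le; first exact: ltW.
    by move=> i; rewrite !mxE.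
apply/cvgrPdist_le => e e0.
(* Chosen so that [L * dl] and [2 M] times [r * eta] are each at most [e / 4]; the two limits take
   the other half of [e]. The added ones keep the denominators positive. *)
pose dl := e / (4 * (L + 1)); pose eta := e / (8 * (M + 1) * (r%:R + 1)).
have L1 : 0 < L + 1 by rewrite ltr_wpDl.
have M1 : 0 < M + 1 by rewrite ltr_wpDl.
have r1 : 0 < r%:R + 1 :> R by rewrite ltr_wpDl.
have dl0 : 0 < dl by rewrite divr_gt0// mulr_gt0.
have eta0 : 0 < eta by rewrite divr_gt0// !mulr_gt0.
have e40 : 0 < e / 4 by rewrite divr_gt0.
have cl : \forall m \near \oo, forall i : 'I_r, \forall n \near \oo,
    Ex P (\1_[set w | dl < `|V n w ord0 i - Vm m n w ord0 i|]) <= eta.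
  by apply: filter_forall => i; exact: close.
have := cvW; move=> /cvgrPdist_le /(_ _ e40) cvW'.
have [m [hm cm]] := filter_ex (filterI cvW' cl).
have := @cvg_m m g cg (ex_intro _ M gM) => /cvgrPdist_le /(_ _ e40) cP.
have cm' : \forall n \near \oo, forall i : 'I_r,
  Ex P (\1_[set w | dl < `|V n w ord0 i - Vm m n w ord0 i|]) <= eta.
  exact: filter_forall.
move: cP cm'; apply: filterS2 => n hn hc.
have mset i : measurable [set w | dl < `|V n w ord0 i - Vm m n w ord0 i|].
  by apply: measurable_set_lt; apply: measurableT_comp => //; apply: measurable_funB.
have key : `|Ex P (fun w => g (Vm m n w)) - Ex P (fun w => g (V n w))| <= e / 2.
  rewrite -ExB; [|exact: bg..].
  apply: (le_trans (ler_norm_Ex _ _)); first by apply: bounded_mfunB; exact: bg.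
  apply: (@le_trans _ _ (Ex P (fun w => L * dl + 2 * M *
     \sum_(i < r) \1_[set w | dl < `|V n w ord0 i - Vm m n w ord0 i|] w))).
    apply: le_Ex.
    - by apply: bounded_mfun_norm; apply: bounded_mfunB; exact: bg.
    - apply: bounded_mfunD; first exact: bounded_mfun_cst.
      apply: bounded_mfunZ; apply: bounded_mfun_sum => i _.
      exact: bounded_mfun_indic.
    - move=> w; have s0 (j : 'I_r) : 0 <= \1_[set w | dl < `|V n w ord0 j - Vm m n w ord0 j|] w :> R.
        by rewrite indicE ler0n.
      have [/existsP[i hi]|] := boolP [exists i : 'I_r, dl < `|V n w ord0 i - Vm m n w ord0 i|].
        apply: (@le_trans _ _ (2 * M)).
          by rewrite (le_trans (ler_normB _ _))// mulrDl mul1r lerD.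
        rewrite (bigD1 i)//= {1}indicE mem_set// mulrDr mulr1 addrCA lerDl.
        apply: addr_ge0; first exact: mulr_ge0 L0 (ltW dl0).
        by apply: mulr_ge0; [exact: mulr_ge0|exact: sumr_ge0].
      rewrite negb_exists => /forallP h.
      rewrite -[leLHS]addr0 lerD//; last by rewrite !mulr_ge0// sumr_ge0.
      apply: (le_trans (Lg _ _)); rewrite ler_wpM2l// norm_rV_le ?(ltW dl0)// => i.
      by rewrite !mxE -normrN opprB leNgt h.
  rewrite ExD; first last.
  - apply: bounded_mfunZ; apply: bounded_mfun_sum => i _; exact: bounded_mfun_indic.
  - exact: bounded_mfun_cst.
  rewrite Ex_cst ExZ; last by apply: bounded_mfun_sum => i _; exact: bounded_mfun_indic.
  rewrite Ex_sum; last by move=> i _; exact: bounded_mfun_indic.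
  have : \sum_(i < r) Ex P (\1_[set w | dl < `|V n w ord0 i - Vm m n w ord0 i|]) <= r%:R * eta.
    rewrite mulr_natl -[r in leRHS]card_ord -sumr_const; exact: ler_sum.
  set s := \sum_(i < r) _ => hs.
  have h1 : L * dl <= e / 4.
    have -> : e / 4 = (L + 1) * dl by rewrite /dl; field; rewrite gt_eqF.
    by rewrite ler_wpM2r ?(ltW dl0)// lerDl.
  have h2 : 2 * M * s <= e / 4.
    have -> : e / 4 = 2 * (M + 1) * ((r%:R + 1) * eta).
      by rewrite /eta; field; rewrite !gt_eqF.
    apply: (@le_trans _ _ (2 * M * ((r%:R + 1) * eta))).
      rewrite ler_wpM2l ?mulr_ge0// (le_trans hs)// ler_wpM2r ?(ltW eta0)//.
      by rewrite lerDl.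
    rewrite ler_wpM2r ?ler_pM2l ?lerDl//.
    by rewrite mulr_ge0 ?(ltW r1) ?(ltW eta0).
  lra.
move: hm hn key; rewrite !ler_norml => /andP[? ?] /andP[? ?] /andP[? ?].
by apply/andP; split; lra.
Qed.

End ConvergingTogether.

End ConvergenceInDistribution.

(** * Atoms and quotients *)

Section Atom.
Context {R : realType} {d : measure_display} {T : measurableType d}.

(* A Fejer-kernel argument: the indicator of [Y = 0] is bounded by
   N^-2 |sum_(j < N) e^(i j v Y)|^2, whose off-diagonal terms vanish in mean
   as v grows. *)
Lemma Ex_atom0 (P : probability T R) (Y : T -> R) (kappa b : R) :
  measurable_fun setT Y -> 0 < kappa -> 0 < b ->
  (forall u, `|Ex P (fun w => cos (u * Y w))| <= expR (- (kappa * `|u| `^ b))) ->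
  Ex P (\1_[set w | Y w = 0]) = 0.
Proof.
move=> mY k0 b0 cf.
have mA : measurable [set w | Y w = 0].
  by have := mY measurableT [set 0] (measurable_set1 _); rewrite setTI.
apply/eqP; rewrite eq_le Ex_ge0 ?andbT; last by move=> w; rewrite indicE ler0n.
apply/ler_addgt0Pr => e e0; rewrite add0r.
have e20 : 0 < e / 2 by rewrite divr_gt0.
have [n _ /(_ n (leqnn n)) /= Ne] := @near_infty_natSinv_lt R (PosNum e20).
pose N := n.+1.
have N0 : 0 < N%:R :> R by rewrite ltr0n.
(* Gives [kappa * v^b = 2 / e], so the characteristic function beyond [v] is at most
   [exp (- 2 / e) <= e / 2]. *)
pose v := (2 / e / kappa) `^ b^-1.
have v0 : 0 < v by rewrite powR_gt0// !divr_gt0.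
have vb : kappa * v `^ b = 2 / e.
  rewrite /v -powRrM mulVf ?gt_eqF// powRr1 ?divr_ge0 ?(ltW e0) ?(ltW k0)//.
  by rewrite mulrCA mulfV ?mulr1// gt_eqF.
have offdiag u : v <= `|u| -> Ex P (fun w => cos (u * Y w)) <= e / 2.
  move=> vu; apply: (le_trans (ler_norm _)); apply: (le_trans (cf u)).
  have : expR (- (kappa * `|u| `^ b)) <= expR (- (2 / e)).
    rewrite ler_expR lerN2 -vb ler_wpM2l ?(ltW k0)//.
    by apply: ge0_ler_powR; rewrite ?nnegrE ?(ltW b0) ?(ltW v0).
  move=> /le_trans; apply; rewrite expRN -[e / 2]invrK invf_div.
  rewrite lef_pV2 ?posrE ?expR_gt0 ?divr_gt0//.
  by apply: le_trans (expR_ge1Dx _); rewrite lerDr.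
have bc j k : bounded_mfun (fun w => cos ((j%:R - k%:R) * v * Y w)).
  by apply: bounded_mfun_cos; apply: measurable_funM => //; exact: measurable_cst.
pose F w := N%:R^-2 * \sum_(j < N) \sum_(k < N) cos ((j%:R - k%:R) * v * Y w).
have bF : bounded_mfun F.
  by apply: bounded_mfunZ; apply: bounded_mfun_sum => j _; apply: bounded_mfun_sum.
have indF w : \1_[set w | Y w = 0] w <= F w.
  have FE : F w = N%:R^-2 * ((\sum_(j < N) cos (j%:R * v * Y w)) ^+ 2 +
                        (\sum_(j < N) sin (j%:R * v * Y w)) ^+ 2).
    rewrite /F; congr (_ * _); rewrite !expr2 !mulr_suml -big_split /=.
    apply: eq_bigr => j _; rewrite !mulr_sumr -big_split /=; apply: eq_bigr => k _.
    by rewrite -cosB -mulrBl -mulrBl.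
  rewrite indicE; case: (boolP (w \in _)) => [|_].
    rewrite inE /= => Y0; rewrite FE Y0.
    under eq_bigr do rewrite mulr0 cos0.
    rewrite sumr_const card_ord.
    rewrite mulrDr mulVf; last by rewrite expf_neq0// gt_eqF.
    by rewrite lerDl; apply: mulr_ge0; rewrite ?invr_ge0 sqr_ge0.
  by rewrite FE mulr_ge0 ?invr_ge0 ?sqr_ge0// addr_ge0 ?sqr_ge0.
apply: (le_trans (le_Ex P (bounded_mfun_indic mA) bF indF)).
rewrite ExZ; last by apply: bounded_mfun_sum => j _; apply: bounded_mfun_sum.
rewrite Ex_sum; last by move=> j _; apply: bounded_mfun_sum.
have row (j : 'I_N) : Ex P (fun w => \sum_(k < N) cos ((j%:R - k%:R) * v * Y w)) <=
    1 + N%:R * (e / 2).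
  rewrite Ex_sum// (bigD1 j)//=; apply: lerD.
    rewrite -[leRHS](Ex_cst P); apply: le_Ex => [//||w]; last exact: cos_le1.
    exact: bounded_mfun_cst.
  apply: (@le_trans _ _ (\sum_(k < N) e / 2)); last first.
    by rewrite sumr_const card_ord mulr_natl.
  rewrite [leRHS](bigD1 j)//= -[leLHS]add0r lerD// ?(ltW e20)//.
  apply: ler_sum => k kj; apply: offdiag; rewrite normrM (gtr0_norm v0) ler_peMl ?(ltW v0)//.
  (* Distinct indices differ by at least 1, so every off-diagonal frequency is at least [v] in
     absolute value. *)
  have : (j%:Z - k%:Z != 0)%R by rewrite subr_eq0 eqz_nat; apply: contra kj => /eqP jk; apply/eqP/val_inj.
  rewrite -normr_gt0 gtz0_ge1 => h.
  by rewrite -(ler_int R) in h; move: h; rewrite intr_norm rmorphB.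
apply: (@le_trans _ _ (N%:R^-2 * (N%:R * (1 + N%:R * (e / 2))))).
  rewrite ler_wpM2l ?invr_ge0 ?sqr_ge0//.
  apply: (@le_trans _ _ (\sum_(j < N) (1 + N%:R * (e / 2)))); first exact: ler_sum.
  by rewrite sumr_const card_ord [leRHS]mulr_natl.
have -> : N%:R^-2 * (N%:R * (1 + N%:R * (e / 2))) = N%:R^-1 + e / 2.
  by field; rewrite gt_eqF.
by move: Ne; rewrite -/N => /ltW; lra.
Qed.

End Atom.

(** * Continuous mapping for division by a coordinate without atom at 0 *)

Section Quotient.
Context {R : realType}.

(** For [eta > 0], a continuous stand-in for the inverse, exact once [y^2 >= eta]. Its value 0 at 0
    matches the convention that the inverse of 0 is 0, so it converges to the inverse at every point
    as [eta] tends to 0. *)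
Definition reg_inv (eta y : R) : R := y / Num.max (y ^+ 2) eta.

Lemma continuous_reg_inv (eta : R) : 0 < eta -> continuous (reg_inv eta).
Proof.
move=> eta0 y.
apply: (@continuousM R R id (fun z => (Num.max (z ^+ 2) eta)^-1)); first exact: cvg_id.
apply: continuousV.
  by rewrite gt_eqF// lt_max eta0 orbT.
apply: (@continuous_max R R (fun y => y ^+ 2) (fun=> eta)); last exact: cvg_cst.
exact: exprn_continuous.
Qed.

Lemma reg_invE (eta y : R) : eta <= y ^+ 2 -> reg_inv eta y = y^-1.
Proof.
move=> h; rewrite /reg_inv max_l// expr2.
by have [->|y0] := eqVneq y 0; [rewrite invr0 !mul0r|field].
Qed.

Lemma cvg_reg_inv (y : R) : reg_inv k.+1%:R^-1 y @[k --> \oo] --> y^-1.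
Proof.
have [->|y0] := eqVneq y 0.
  by rewrite invr0; apply: cvg_near_cst; apply: nearW => k; rewrite /reg_inv mul0r.
have y20 : 0 < y ^+ 2 by rewrite exprn_even_gt0.
apply: cvg_near_cst; near=> k; apply: reg_invE; apply: ltW.
by near: k; exact: (@near_infty_natSinv_lt R (PosNum y20)).
Unshelve. all: by end_near. Qed.

Lemma measurable_inv : measurable_fun setT (@GRing.inv R).
Proof.
apply: (@measurable_fun_cvg _ _ _ _ (fun k => reg_inv k.+1%:R^-1)).
  by move=> k; apply: continuous_measurable_fun; exact: continuous_reg_inv.
by move=> y _; exact: cvg_reg_inv.
Qed.

Lemma measurable_fun_div {d} {T : measurableType d} (f g : T -> R) :
  measurable_fun setT f -> measurable_fun setT g ->
  measurable_fun setT (fun w => f w / g w).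
Proof.
move=> mf mg; apply: measurable_funM => //.
exact: measurableT_comp measurable_inv mg.
Qed.

Lemma continuous_rV_comp (r s : nat) (f : 'rV[R]_r -> R) (q : 'rV[R]_s -> 'rV[R]_r) :
  continuous f -> (forall i, continuous (fun x => q x ord0 i)) ->
  continuous (fun x => f (q x)).
Proof.
move=> cf cq x; apply/continuous_rVP => e /((continuous_rVP f (q x)).1 (cf (q x)))[dl dl0 h].
have dl20 : 0 < dl / 2 by rewrite divr_gt0.
have near_q : \forall y \near nbhs x, forall i, `|q x ord0 i - q y ord0 i| <= dl / 2.
  apply: filter_forall => i.
  have [e' e'0 he'] := (continuous_rVP (fun x => q x ord0 i) x).1 (cq i x) _ dl20.
  by apply/nbhs_ballP; exists e' => // y; rewrite mx_norm_ball => /he'.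
move/nbhs_ballP : near_q => [e' e'0 he']; exists e' => // y xy.
apply: h; apply: le_lt_trans (_ : dl / 2 < dl); last by rewrite ltr_pdivrMr// ltr_pMr// ltr1n.
apply: norm_rV_le; first exact: ltW.
by move=> i; rewrite !mxE; apply: he'; rewrite mx_norm_ball.
Qed.

Lemma cvg_in_distribution_map {d d'} {T : measurableType d} {T' : measurableType d'}
  (r s : nat) (P : probability T R) (Q : probability T' R)
  (V : nat -> T -> 'rV[R]_s) (W : T' -> 'rV[R]_s) (q : 'rV[R]_s -> 'rV[R]_r) :
  (forall i, continuous (fun x => q x ord0 i)) ->
  cvg_in_distribution P V Q W ->
  cvg_in_distribution P (fun n w => q (V n w)) Q (fun w => q (W w)).
Proof.
move=> cq cV f cf [M fM].
by apply: (cV (fun x => f (q x))); [exact: continuous_rV_comp|exists M => x].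
Qed.

Definition quo_rV (r : nat) (x : 'rV[R]_r.+1) : 'rV[R]_r :=
  \row_i (x ord0 (lift ord0 i) / x ord0 ord0).

Definition reg_quo_rV (r : nat) (eta : R) (x : 'rV[R]_r.+1) : 'rV[R]_r :=
  \row_i (x ord0 (lift ord0 i) * reg_inv eta (x ord0 ord0)).

(** For [eta > 0], a continuous bump equal to 1 for [y^2 <= eta] and to 0 for [y^2 >= 2 eta].
    Continuity lets its mean pass to the limit in distribution, unlike that of an indicator. *)
Definition near0_cutoff (eta y : R) : R := Num.max 0 (Num.min 1 (2 - y ^+ 2 / eta)).

Lemma near0_cutoff_itv (eta y : R) : 0 <= near0_cutoff eta y <= 1.
Proof. by rewrite /near0_cutoff le_max lexx ge_max ler01 ge_min lexx. Qed.

Lemma near0_cutoff_eq1 (eta y : R) : 0 < eta -> y ^+ 2 < eta -> near0_cutoff eta y = 1.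
Proof.
move=> eta0 h; rewrite /near0_cutoff min_l ?max_r//.
have : y ^+ 2 / eta <= 1 by rewrite ler_pdivrMr// mul1r ltW.
lra.
Qed.

Lemma continuous_near0_cutoff (eta : R) : continuous (near0_cutoff eta).
Proof.
move=> y; apply: (@continuous_max R R (fun=> 0) (fun y => Num.min 1 (2 - y ^+ 2 / eta))).
  exact: cvg_cst.
apply: (@continuous_min R R (fun=> 1) (fun y => 2 - y ^+ 2 / eta)); first exact: cvg_cst.
apply: continuousB; first exact: cvg_cst.
by apply: continuousM; [exact: exprn_continuous|exact: cvg_cst].
Qed.

(** Regularising the division costs at most [2 M] times the mean of the cutoff. This mean converges
    along [V n] to its value under [W], which tends to the probability of a zero denominator, that
    is 0, as [eta] shrinks. *)
Lemma cvg_in_distribution_quo {d d'} {T : measurableType d} {T' : measurableType d'}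
  (r : nat) (P : probability T R) (Q : probability T' R)
  (V : nat -> T -> 'rV[R]_r.+1) (W : T' -> 'rV[R]_r.+1) :
  (forall n i, measurable_fun setT (fun w => V n w ord0 i)) ->
  (forall i, measurable_fun setT (fun w => W w ord0 i)) ->
  Ex Q (\1_[set w | W w ord0 ord0 = 0]) = 0 ->
  cvg_in_distribution P V Q W ->
  cvg_in_distribution P (fun n w => quo_rV (V n w)) Q (fun w => quo_rV (W w)).
Proof.
move=> mV mW W0 cV f cf [M fM].
have M0 : 0 <= M by apply: le_trans (fM 0).
have b_quo d0 (T0 : measurableType d0) (U : T0 -> 'rV[R]_r.+1) :
    (forall i, measurable_fun setT (fun w => U w ord0 i)) ->
    bounded_mfun (fun w => f (quo_rV (U w))).
  move=> mU; apply: bounded_mfun_continuous_rV => //; last by exists M.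
  move=> i; rewrite (_ : (fun w => _) = fun w => U w ord0 (lift ord0 i) / U w ord0 ord0).
    exact: measurable_fun_div.
  by apply/funext => w; rewrite mxE.
have c_reg eta : 0 < eta -> continuous (fun x => f (@reg_quo_rV r eta x)).
  move=> eta0; apply: continuous_rV_comp => // i.
  rewrite (_ : (fun x => _) = fun x : 'rV[R]_r.+1 =>
      x ord0 (lift ord0 i) * reg_inv eta (x ord0 ord0)); last first.
    by apply/funext => x; rewrite mxE.
  move=> x; apply: (@continuousM R 'rV[R]_r.+1 (fun x => x ord0 (lift ord0 i))
    (fun x => reg_inv eta (x ord0 ord0))); first exact: coord_continuous.
  apply: (continuous_comp (f := fun x : 'rV[R]_r.+1 => x ord0 ord0)).
    exact: coord_continuous.
  exact: continuous_reg_inv.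
have c_cut eta : continuous (fun x : 'rV[R]_r.+1 => near0_cutoff eta (x ord0 ord0)).
  move=> x; apply: (continuous_comp (f := fun x : 'rV[R]_r.+1 => x ord0 ord0)).
    exact: coord_continuous.
  exact: continuous_near0_cutoff.
have cut1 eta : exists M : R, forall x : 'rV[R]_r.+1, `|near0_cutoff eta (x ord0 ord0)| <= M.
  exists 1 => x; have /andP[h0 h1] := near0_cutoff_itv eta (x ord0 ord0).
  by rewrite ger0_norm.
have diff d0 (T0 : measurableType d0) (P0 : probability T0 R) (U : T0 -> 'rV[R]_r.+1) eta :
    0 < eta -> (forall i, measurable_fun setT (fun w => U w ord0 i)) ->
    `|Ex P0 (fun w => f (quo_rV (U w))) - Ex P0 (fun w => f (reg_quo_rV eta (U w)))| <=
    2 * M * Ex P0 (fun w => near0_cutoff eta (U w ord0 ord0)).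
  move=> eta0 mU.
  have breg : bounded_mfun (fun w => f (reg_quo_rV eta (U w))).
    by apply: (bounded_mfun_continuous_rV mU (c_reg eta eta0)); exists M.
  have bcut : bounded_mfun (fun w => near0_cutoff eta (U w ord0 ord0)).
    exact: (bounded_mfun_continuous_rV mU (c_cut eta)).
  rewrite -ExB//; last exact: b_quo.
  have bdiff := bounded_mfunB (b_quo _ _ _ mU) breg.
  apply: (le_trans (ler_norm_Ex _ bdiff)); rewrite -ExZ//; apply: le_Ex.
  - exact: bounded_mfun_norm.
  - exact: bounded_mfunZ.
  move=> w; have [h|h] := leP eta (U w ord0 ord0 ^+ 2).
    have -> : reg_quo_rV eta (U w) = quo_rV (U w).
      by apply/rowP => i; rewrite !mxE reg_invE.
    rewrite subrr normr0 !mulr_ge0//.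
    by have /andP[] := near0_cutoff_itv eta (U w ord0 ord0).
  rewrite near0_cutoff_eq1// mulr1 (le_trans (ler_normB _ _))//.
  by rewrite mulrDl mul1r lerD.
have cutW : Ex Q (fun w => near0_cutoff k.+1%:R^-1 (W w ord0 ord0)) @[k --> \oo] --> 0.
  rewrite -W0; apply: (dominated_cvg_Ex (M := 1)).
  - by move=> k; exact: (measurable_continuous_rV mW (c_cut k.+1%:R^-1)).
  - apply: measurable_indic.
    by have := mW ord0 measurableT [set 0] (measurable_set1 _); rewrite setTI.
  - move=> k w; have /andP[h0 h1] := near0_cutoff_itv k.+1%:R^-1 (W w ord0 ord0).
    by rewrite ger0_norm.
  - apply: aeW => w; apply: cvg_near_cst.
    have [h|h] := eqVneq (W w ord0 ord0) 0.
      apply: nearW => k; rewrite indicE mem_set//; apply: near0_cutoff_eq1 => //.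
      by rewrite h expr0n /= invr_gt0 ltr0n.
    have y20 : 0 < (W w ord0 ord0 ^+ 2) / 2 by apply: divr_gt0 => //; rewrite exprn_even_gt0.
    near=> k; rewrite indicE memNset/=; last exact/eqP.
    rewrite /near0_cutoff invrK; apply/max_idPl; rewrite ge_min; apply/orP; right.
    have hk : k.+1%:R^-1 < W w ord0 ord0 ^+ 2 / 2.
      by near: k; exact: (@near_infty_natSinv_lt R (PosNum y20)).
    move: hk; rewrite ltr_pdivlMr// mulrC ltr_pdivrMr// => /ltW; lra.
apply/cvgrPdist_le => e e0.
have M1 : 0 < 2 * M + 1 by rewrite ltr_wpDl// mulr_ge0.
pose e1 := e / (6 * (2 * M + 1)).
have e10 : 0 < e1 by rewrite divr_gt0// mulr_gt0.
have e1M : 2 * M * e1 <= e / 6.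
  have -> : e / 6 = (2 * M + 1) * e1 by rewrite /e1; field; rewrite gt_eqF.
  by rewrite ler_wpM2r ?(ltW e10)// lerDl.
have e60 : 0 < e / 6 by rewrite divr_gt0.
move/cvgrPdist_le : cutW => /(_ _ e10)[k _ /(_ k (leqnn k))] /=.
rewrite sub0r normrN => cutk.
pose eta : R := k.+1%:R^-1.
have eta0 : 0 < eta by rewrite invr_gt0 ltr0n.
have := cV _ (c_reg eta eta0) (ex_intro _ M (fun x => fM _)).
move=> /cvgrPdist_le /(_ _ e60); have := cV _ (c_cut eta) (cut1 eta).
move=> /cvgrPdist_le /(_ _ e10); apply: filterS2 => n h1 h2.
have h3 := diff _ _ P (V n) eta eta0 (mV n).
have h4 := diff _ _ Q W eta eta0 mW.
move: h1 h2 h3 h4 cutk; rewrite -/eta.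
set cW := Ex Q _; set cVn := Ex P _ => h1 h2 h3 h4 cutk.
have hc : cW <= e1 by apply: le_trans cutk; exact: ler_norm.
have hcv : cVn <= 2 * e1 by move: h1; rewrite ler_norml => /andP[? ?]; lra.
have h3' : 2 * M * cVn <= e / 3.
  apply: (@le_trans _ _ (2 * M * (2 * e1))); first by rewrite ler_wpM2l// mulr_ge0.
  by rewrite mulrCA; lra.
have h4' : 2 * M * cW <= e / 6.
  by apply: le_trans e1M; rewrite ler_wpM2l// mulr_ge0.
move: h2 h3 h4; rewrite !ler_norml => /andP[? ?] /andP[? ?] /andP[? ?].
by apply/andP; split; lra.
Unshelve. all: by end_near. Qed.

End Quotient.

(** * Sample autocovariances *)

Section SampleAutocovariances.
Context {R : realType}.

(** Groups the products [eps s * eps t] by their later index [t], which exhibits the sum as a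
    transform with predictable factors. Going from [n] to [n + 1] adds exactly the products that
    contain [eps n.+1]. *)
Lemma ngamma_quadratic {T} (eps : nat -> T -> R) (b : nat -> R) n w :
  \sum_(1 <= k < n) b k * ngamma eps n k w =
  \sum_(1 <= t < n.+1) eps t w * \sum_(1 <= s < t) b (t - s)%N * eps s w.
Proof.
elim: n => [|n IH]; first by rewrite !big_geq.
have [->|n0] := posnP n.
  by rewrite big_geq// big_nat1 big_geq// mulr0.
rewrite [RHS]big_nat_recr//= -IH.
transitivity (\sum_(1 <= k < n.+1) (b k * ngamma eps n k w +
    b k * (eps (n.+1 - k)%N w * eps n.+1 w))).
  rewrite big_nat [RHS]big_nat; apply: eq_bigr => k /andP[k1 kn].
  rewrite -mulrDr; congr (_ * _); rewrite /ngamma subSn//.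
  rewrite big_nat_recr//=; congr (_ + _ * eps _ w).
  by rewrite -[LHS]/((n - k).+1 + k)%N addSn subnK.
rewrite big_split /= big_nat_recr//=.
have -> : ngamma eps n n w = 0 by rewrite /ngamma subnn big_geq.
rewrite mulr0 addr0; congr (_ + _).
rewrite mulr_sumr [RHS]big_nat_rev /= big_nat [RHS]big_nat.
apply: eq_bigr => k /andP[k1 kn].
by rewrite add1n subSS subKn ?(ltnW kn)//; ring.
Qed.

Lemma measurable_ngamma {d} {T : measurableType d} (eps : nat -> T -> R) n k :
  (forall t, measurable_fun setT (eps t)) ->
  measurable_fun setT (ngamma eps n k).
Proof.
by move=> meps; apply: measurable_bigsum => t _; exact: measurable_funM.
Qed.

(** The number of halvings is at most [1 + ln n / ln 2], and the 1 is absorbed because [n >= 2]. *)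
Lemma up_log2_le_ln n : (1 < n)%N -> (up_log 2 n)%:R * ln 2 <= 2 * ln n%:R :> R.
Proof.
move=> n1; have n2 : (2 <= n%:R :> R) by rewrite ler_nat.
have l2n : ln 2 <= ln n%:R :> R by rewrite ler_ln// ?posrE// (lt_le_trans _ n2).
have ul0 : (0 < up_log 2 n)%N by rewrite up_log_gt0.
have := up_log_gtn (isT : (1 < 2)%N) n1.
rewrite -(ltr_nat R) natrX => h.
have : ln (2 ^+ (up_log 2 n).-1) <= ln n%:R :> R.
  by rewrite ler_ln ?posrE ?exprn_gt0// ?ltW// (lt_le_trans _ n2).
rewrite lnXn// -mulr_natl -{2}(prednK ul0) -[in X in _ -> X]natr1 mulrDl mul1r.
lra.
Qed.

(** * Error of truncating the coefficients to finitely many lags *)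

Section TruncationError.
Context {d : measure_display} {T : measurableType d}.
Variables (P : probability T R) (alpha : R) (eps : nat -> T -> R).
Hypothesis alpha0 : 0 < alpha.
Hypothesis meps : forall t, measurable_fun setT (eps t).
Hypothesis indep : mutually_independent P eps.
Hypothesis cfeps : forall t (u : R),
  Ex P (fun w => cos (u * eps t w)) = expR (- (`|u| `^ alpha)) /\
  Ex P (fun w => sin (u * eps t w)) = 0.
Variable a : nat -> R.
Hypothesis suma : (\sum_(1 <= k <oo) (`|a k| `^ alpha)%:E < +oo)%E.

Let scale n : R := (n%:R * ln n%:R) `^ alpha^-1.

Let K : R := 3 * (12 * 1 + 1).

Lemma Xn_truncation_tail (dl e : R) : 0 < dl -> 0 < e ->
  exists m0, forall m, (m0 <= m)%N -> \forall n \near \oo,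
    Ex P (\1_[set w | dl < `|Xn alpha eps a n w -
      (scale n)^-1 * \sum_(1 <= k < m) a k * ngamma eps n k w|]) <= e.
Proof.
move=> dl0 e0.
have K0 : 0 < K by rewrite /K; lra.
have ln20 : 0 < ln 2 :> R by rewrite ln_gt0// ltr1n.
pose q := (4 / dl) `^ alpha.
have q0 : 0 < q by rewrite powR_gt0// divr_gt0.
(* Fitted to the end of the estimate: with [J * ln 2 <= 4 ln n] and [n + 1 <= 2 n], the dyadic part
   of [quadratic_tail] becomes exactly [e / 2]. *)
pose B := e * ln 2 / (32 * K ^+ 2 * q).
have B0 : 0 < B by rewrite divr_gt0 ?mulr_gt0// exprn_gt0.
have [m0 tail] := summable_tail (fun k => powR_ge0 _ _) suma B0.
exists m0.+1 => m mm0.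
have m1 : (1 <= m)%N by exact: leq_trans mm0.
near=> n.
have n1 : (1 < n)%N by near: n; exists 2%N.
have mn : (m <= n)%N by near: n; exists m.
(* Makes the remaining part, [2 K / n], at most [e / 2]. *)
have nK : 4 * K / e <= n%:R by near: n; exact: nbhs_infty_ger.
have n0 : 0 < n%:R :> R by rewrite ltr0n ltnW.
have L0 : 0 < ln n%:R :> R by rewrite ln_gt0// ltr1n.
have s0 : 0 < scale n by rewrite powR_gt0// mulr_gt0.
pose b k := if (k < m)%N then 0 else a k.
have bB t : \sum_(1 <= k < t) `|b k| `^ alpha <= B.
  apply: le_trans (tail m t (ltnW mm0)).
  have [tm|mt] := leqP t m.
    rewrite big_nat big1; first by rewrite big_geq.
    by move=> k /andP[_ kt]; rewrite /b (leq_trans kt tm) normr0 powR0// gt_eqF.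
  rewrite (big_cat_nat m1 (ltnW mt))/= big_nat big1 ?add0r.
    by rewrite big_nat [leRHS]big_nat; apply: ler_sum => k /andP[mk _]; rewrite /b ltnNge mk.
  by move=> k /andP[_ km]; rewrite /b km normr0 powR0// gt_eqF.
have y0 : 0 < dl * scale n by exact: mulr_gt0.
have c1 t u : (0 < t)%N -> Ex P (fun w => cos (u * eps t w)) = expR (- (1 * `|u| `^ alpha)).
  by move=> _; rewrite mul1r; case: (cfeps t u).
have c2 t u : (0 < t)%N -> Ex P (fun w => sin (u * eps t w)) = 0.
  by move=> _; case: (cfeps t u).
(* With twice [up_log 2 n] levels the residue [2^-J] is at most [n^-2], so [n] copies of it still
   vanish. The range ends at [n.+1] because the later index of a product can be [n]. *)
have := quadratic_tail alpha0 ler01 meps indep c1 c2 n.+1 (2 * up_log 2 n) y0 bB.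
rewrite (_ : [set w | dl * _ < _] = [set w | dl < `|Xn alpha eps a n w -
      (scale n)^-1 * \sum_(1 <= k < m) a k * ngamma eps n k w|]); last first.
  have XE w : Xn alpha eps a n w - (scale n)^-1 * \sum_(1 <= k < m) a k * ngamma eps n k w =
      (scale n)^-1 * \sum_(1 <= k < n) b k * ngamma eps n k w.
    rewrite /Xn -/(scale n) -mulrBr; congr (_ * _).
    rewrite (big_cat_nat m1 mn)/= addrAC subrr add0r.
    rewrite [RHS](big_cat_nat m1 mn)/= [X in _ = X + _]big_nat [X in _ = X + _]big1 ?add0r.
      by rewrite big_nat [RHS]big_nat; apply: eq_bigr => k /andP[mk _]; rewrite /b ltnNge mk.
    by move=> k /andP[_ km]; rewrite /b km mul0r.
  apply/seteqP; split => w /=; rewrite XE ngamma_quadratic normrM gtr0_norm ?invr_gt0//;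
    by rewrite [_^-1 * _]mulrC ltr_pdivlMr.
move=> /le_trans; apply; rewrite -/K.
have -> : (4 / (dl * scale n)) `^ alpha = q / (n%:R * ln n%:R).
  rewrite invfM mulrA powRM ?invr_ge0 ?(ltW s0) ?divr_ge0 ?(ltW dl0)//; congr (_ * _).
  rewrite -powRN -powRrM mulNr mulVf ?gt_eqF// powR_inv1// ?mulr_ge0 ?(ltW n0) ?(ltW L0)//.
set J := (2 * up_log 2 n)%N.
have J1 : 2^-1 ^+ J <= n%:R^-1 * n%:R^-1 :> R.
  have h : 2^-1 ^+ up_log 2 n <= n%:R^-1 :> R.
    rewrite exprVn lef_pV2 ?posrE ?exprn_gt0//.
    by rewrite -natrX ler_nat; exact: up_logP.
  rewrite /J mul2n -addnn exprD; apply: ler_pM => //; exact: exprn_ge0.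
have J2 : J%:R * ln 2 <= 4 * ln n%:R :> R.
  by have := up_log2_le_ln n1; rewrite /J natrM; lra.
have n2 : n.+1%:R <= 2 * n%:R :> R.
  by rewrite -natrM ler_nat mul2n -addnn -addn1 leq_add2l ltnW.
have h2 : 2 * (K * (q / (n%:R * ln n%:R)) * B) * J%:R <= n%:R^-1 * (e / (4 * K)).
  have -> : 2 * (K * (q / (n%:R * ln n%:R)) * B) * J%:R =
      (e / (16 * K * n%:R * ln n%:R)) * (J%:R * ln 2).
    rewrite /B; field.
    by rewrite !gt_eqF.
  apply: (@le_trans _ _ ((e / (16 * K * n%:R * ln n%:R)) * (4 * ln n%:R))).
    apply: ler_wpM2l J2; apply: divr_ge0; first exact: ltW.
    by rewrite !mulr_ge0// ltW.
  rewrite le_eqVlt; apply/orP; left; apply/eqP; field.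
  by rewrite !gt_eqF.
apply: (@le_trans _ _ (K * (2 * n%:R) * (n%:R^-1 * n%:R^-1 + n%:R^-1 * (e / (4 * K))))).
  apply: ler_pM => //.
  - by rewrite mulr_ge0// ltW.
  - apply: addr_ge0; first exact: exprn_ge0.
    do 2! apply: mulr_ge0 => //; apply: mulr_ge0; last exact: ltW.
    apply: mulr_ge0; first exact: ltW.
    by apply: divr_ge0; [exact: ltW|apply: mulr_ge0; exact: ltW].
  - by rewrite ler_wpM2l// ltW.
  - exact: lerD.
have -> : K * (2 * n%:R) * (n%:R^-1 * n%:R^-1 + n%:R^-1 * (e / (4 * K))) =
    2 * K / n%:R + e / 2.
  by field; rewrite !gt_eqF.
have : 2 * K / n%:R <= e / 2.
  rewrite ler_pdivrMr//; move: nK; rewrite ler_pdivrMr//; lra.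
lra.
Unshelve. all: by end_near. Qed.

End TruncationError.

(** * Stable characteristic functions and the passage from autocovariances to autocorrelations *)

Lemma symmetric_stable_cf {d} {T : measurableType d} (P : probability T R)
  (X : T -> R) (alpha sigma u : R) : 0 < sigma ->
  has_stable_law P X alpha sigma 0 0 ->
  Ex P (fun w => cos (u * X w)) = expR (- (sigma `^ alpha * `|u| `^ alpha)) /\
  Ex P (fun w => sin (u * X w)) = 0.
Proof.
move=> s0 /(_ u)[-> ->].
have -> : stable_logcf_im alpha sigma 0 0 u = 0.
  by rewrite /stable_logcf_im; case: ifP => _; rewrite !(mulr0, mul0r) ?oppr0 addr0.
rewrite cos0 sin0 mulr1 mulr0; split => //; congr expR.
rewrite /stable_logcf_re; case: eqP => // ->.
by rewrite !powRr1// ltW.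
Qed.

(** The skewness enters only through a cosine factor, bounded by 1, so the real part of the
    characteristic function still decays like [exp (- (sigma |u|)^alpha)]. *)
Lemma positive_stable_atom0 {d} {T : measurableType d} (P : probability T R)
  (X : T -> R) (alpha sigma : R) : measurable_fun setT X ->
  0 < alpha < 1 -> 0 < sigma -> has_stable_law P X alpha sigma 1 0 ->
  Ex P (\1_[set w | X w = 0]) = 0.
Proof.
move=> mX /andP[a0 a1] s0 law.
apply: (@Ex_atom0 _ _ _ P X (sigma `^ alpha) alpha) => //; first exact: powR_gt0.
move=> u; case: (law u) => -> _; rewrite normrM.
rewrite (ger0_norm (expR_ge0 _)) {1}/stable_logcf_re (lt_eqF a1).
by rewrite ler_piMr ?expR_ge0// cos_max.
Qed.

Definition cons_rV (r : nat) (x0 : R) (x : 'I_r -> R) : 'rV[R]_r.+1 :=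
  \row_i (if unlift ord0 i is Some j then x j else x0).

Lemma cons_rV0 r x0 (x : 'I_r -> R) : cons_rV x0 x ord0 ord0 = x0.
Proof. by rewrite mxE unlift_none. Qed.

Lemma cons_rVS r x0 (x : 'I_r -> R) j : cons_rV x0 x ord0 (lift ord0 j) = x j.
Proof. by rewrite mxE liftK. Qed.

Definition cons_rVE := (cons_rV0, cons_rVS).

(** The normalisations match: [(n / ln n)^(1/alpha)] is [(n ln n)^(-1/alpha)] times [n^(2/alpha)].
    The condition [1 < n] keeps [ln n] positive. *)
Lemma Xtn_quotient {T} (alpha : R) (eps : nat -> T -> R) a n w : (1 < n)%N ->
  Xtn alpha eps a n w = Xn alpha eps a n w / (ngamma eps n 0 w / n%:R `^ (2 / alpha)).
Proof.
move=> n1; have n0 : 0 < n%:R :> R by rewrite ltr0n ltnW.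
have L0 : 0 < ln n%:R :> R by rewrite ln_gt0// ltr1n.
rewrite /Xtn /Xn.
have -> : \sum_(1 <= k < n) a k * rho_n eps n k w =
    (\sum_(1 <= k < n) a k * ngamma eps n k w) / ngamma eps n 0 w.
  rewrite mulr_suml; apply: eq_bigr => k _; rewrite -mulrA; congr (_ * _).
  by rewrite /rho_n /gamma_n invfM invrK mulrACA mulVf ?mulr1// gt_eqF.
rewrite !powRM ?invr_ge0 ?(ltW n0) ?(ltW L0)//.
have -> : (ln n%:R)^-1 `^ alpha^-1 = (ln n%:R `^ alpha^-1)^-1.
  by rewrite -[(ln n%:R)^-1]powR_inv1 ?(ltW L0)// -powRrM mulN1r powRN.
have -> : n%:R `^ (2 / alpha) = (n%:R `^ alpha^-1) ^+ 2 :> R.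
  by rewrite mulrC powRrM powR_mulrn// powR_ge0.
have N0 : 0 < n%:R `^ alpha^-1 :> R by exact: powR_gt0.
have l0 : 0 < ln n%:R `^ alpha^-1 :> R by exact: powR_gt0.
(* If the denominator vanishes, both sides are 0 by the convention for the inverse of 0. *)
have [->|g0] := eqVneq (ngamma eps n 0 w) 0.
  by rewrite mul0r !invr0 !mulr0.
by field; rewrite g0 !gt_eqF.
Qed.

End SampleAutocovariances.

Unset Implicit Arguments.
Set Strict Implicit.
Set Printing Implicit Defensive.

Theorem theorem3p1 (R : realType) (alpha sigma1 sigma2 : R)
  (d : measure_display) (T : measurableType d) (P : probability T R)
  (eps : nat -> T -> R)
  (d' : measure_display) (T' : measurableType d') (Q : probability T' R)
  (Y : nat -> T' -> R) :
  0 < alpha < 2 -> 0 < sigma1 -> 0 < sigma2 ->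
  (* (eps_t) i.i.d. with E e^{iu eps} = e^{-|u|^alpha} *)
  (forall t, measurable_fun setT (eps t)) ->
  mutually_independent P eps ->
  (forall t (u : R), Ex P (fun w => cos (u * eps t w)) = expR (- (`|u| `^ alpha)) /\
                     Ex P (fun w => sin (u * eps t w)) = 0) ->
  (* Y_0 ~ S_{alpha/2}(sigma1,1,0), Y_1, Y_2, ... ~ S_alpha(sigma2,0,0), independent *)
  (forall k, measurable_fun setT (Y k)) ->
  mutually_independent Q Y ->
  has_stable_law Q (Y 0) (alpha / 2) sigma1 1 0 ->
  (forall k, (1 <= k)%N -> has_stable_law Q (Y k) alpha sigma2 0 0) ->
  (* sigma1, sigma2 are the constants of the joint limit theorem *)
  (forall m, (1 <= m)%N ->
     cvg_in_distribution P
       (fun n w => \row_(i < m.+1)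
          (if (i : nat) == 0%N then ngamma eps n 0 w / n%:R `^ (2 / alpha)
           else ngamma eps n i w / (n%:R * ln n%:R) `^ alpha^-1))
       Q (fun w => \row_(i < m.+1) Y i w)) ->
  (* fidi convergence *)
  forall (r : nat) (A : 'I_r -> nat -> R), (forall i, in_lalogl alpha (A i)) ->
    cvg_in_distribution P (fun n w => \row_(i < r) Xn alpha eps (A i) n w)
                        Q (fun w => \row_(i < r) Ya Y (A i) w) /\
    cvg_in_distribution P (fun n w => \row_(i < r) Xtn alpha eps (A i) n w)
                        Q (fun w => \row_(i < r) Yta Y (A i) w).
Proof.
move=> /andP[alpha0 alpha2] s10 s20 meps ieps cfeps mY iY law0 lawY joint r A sumA.
have sumA1 i : (\sum_(1 <= k <oo) (`|A i k| `^ alpha)%:E < +oo)%E by case: (sumA i).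
have cY k u : (0 < k)%N ->
    Ex Q (fun w => cos (u * Y k w)) = expR (- (sigma2 `^ alpha * `|u| `^ alpha)).
  by move=> k0; have [] := symmetric_stable_cf u s20 (lawY k k0).
have sY k u : (0 < k)%N -> Ex Q (fun w => sin (u * Y k w)) = 0.
  by move=> k0; have [] := symmetric_stable_cf u s20 (lawY k k0).
have sig0 : 0 <= sigma2 `^ alpha by exact: powR_ge0.
pose scale n : R := (n%:R * ln n%:R) `^ alpha^-1.
(* The statistics are carried jointly with the normalised [ngamma eps n 0]: dropping this coordinate
   gives the first claim, dividing by it gives the second. *)
pose V n w : 'rV[R]_r.+1 := cons_rV (ngamma eps n 0 w / n%:R `^ (2 / alpha))
  (fun j => Xn alpha eps (A j) n w).
pose W w : 'rV[R]_r.+1 := cons_rV (Y 0%N w) (fun j => Ya Y (A j) w).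
(* The truncation as a linear map. It keeps the lags [1, ..., m.+1], so the joint limit is used at
   [m.+1], which is at least 1 for every [m]. *)
pose L m (x : 'rV[R]_m.+2) : 'rV[R]_r.+1 := cons_rV (x ord0 ord0)
  (fun j => \sum_(k < m.+1) A j k.+1 * x ord0 (lift ord0 k)).
pose U m n w : 'rV[R]_m.+2 := \row_(i < m.+2)
  (if (i : nat) == 0%N then ngamma eps n 0 w / n%:R `^ (2 / alpha)
   else ngamma eps n i w / (n%:R * ln n%:R) `^ alpha^-1).
pose Z m w : 'rV[R]_m.+2 := \row_(i < m.+2) Y i w.
have ordS s (p : 'I_s.+1 -> Prop) : p ord0 -> (forall j, p (lift ord0 j)) ->
    forall i, p i.
  by move=> p0 pS i; case: (unliftP ord0 i) => [j ->|->].
have mXn j n : measurable_fun setT (Xn alpha eps (A j) n).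
  apply: measurable_funM; first exact: measurable_cst.
  apply: measurable_bigsum => k _; apply: measurable_funM; first exact: measurable_cst.
  exact: measurable_ngamma.
have mV n i : measurable_fun setT (fun w => V n w ord0 i).
  move: i; apply: ordS => [|j].
    under eq_fun do rewrite cons_rV0.
    by apply: measurable_funM; [exact: measurable_ngamma|exact: measurable_cst].
  by under eq_fun do rewrite cons_rVS; exact: mXn.
have mW i : measurable_fun setT (fun w => W w ord0 i).
  move: i; apply: ordS => [|j]; first by under eq_fun do rewrite cons_rV0; exact: mY.
  by under eq_fun do rewrite cons_rVS; exact: measurable_Ya.
have LU m n w j : L m (U m n w) ord0 (lift ord0 j) =
    (scale n)^-1 * \sum_(1 <= k < m.+2) A j k * ngamma eps n k w.
  rewrite cons_rVS big_add1 /= big_mkord mulr_sumr; apply: eq_bigr => k _.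
  by rewrite mxE lift0 /= [RHS]mulrC -mulrA.
have LZ m w j : L m (Z m w) ord0 (lift ord0 j) = \sum_(1 <= k < m.+2) A j k * Y k w.
  by rewrite cons_rVS big_add1 /= big_mkord; apply: eq_bigr => k _; rewrite mxE lift0.
have LU0 m n w : L m (U m n w) ord0 ord0 = ngamma eps n 0 w / n%:R `^ (2 / alpha).
  by rewrite cons_rV0 mxE.
have LZ0 m w : L m (Z m w) ord0 ord0 = Y 0%N w by rewrite cons_rV0 mxE.
have cVW : cvg_in_distribution P V Q W.
  apply: (@converging_together _ _ _ _ _ _ P Q V W
    (fun m n w => L m (U m n w)) (fun m w => L m (Z m w))) => //.
  - move=> m n; apply: ordS => [|j].
      under eq_fun do rewrite LU0.
      by apply: measurable_funM; [exact: measurable_ngamma|exact: measurable_cst].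
    under eq_fun do rewrite LU.
    apply: measurable_funM; first exact: measurable_cst.
    apply: measurable_bigsum => k _; apply: measurable_funM; first exact: measurable_cst.
    exact: measurable_ngamma.
  - move=> m; apply: ordS => [|j]; first by under eq_fun do rewrite LZ0; exact: mY.
    under eq_fun do rewrite LZ.
    by apply: measurable_bigsum => k _; apply: measurable_funM.
  - move=> m; apply: cvg_in_distribution_map; last exact: joint.
    apply: ordS => [|j].
      rewrite (_ : (fun x => _) = fun x : 'rV[R]_m.+2 => x ord0 ord0).
        exact: coord_continuous.
      by apply/funext => x; rewrite cons_rV0.
    rewrite (_ : (fun x => _) = fun x : 'rV[R]_m.+2 =>
        \sum_(k < m.+1) A j k.+1 * x ord0 (lift ord0 k)).
      apply: continuous_big; first exact: add_continuous.
      move=> k _ x; apply: (@continuousM R 'rV[R]_m.+2 (fun=> A j k.+1)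
        (fun x => x ord0 (lift ord0 k))); last exact: coord_continuous.
      exact: cst_continuous.
    by apply/funext => x; rewrite cons_rVS.
  - have : {ae Q, forall w, forall j : 'I_r,
        (fun n => \sum_(1 <= k < n) A j k * Y k w) @ \oo --> Ya Y (A j) w}.
      apply: filter_forall => j.
      exact: (cvg_Ya_ae alpha0 sig0 mY iY cY sY (sumA1 j)).
    apply: filterS => w hw; apply: ordS => [|j].
      rewrite cons_rV0; under eq_fun do rewrite LZ0; exact: cvg_cst.
    rewrite cons_rVS; under eq_fun do rewrite LZ.
    (* The truncation at level [m] sums the indices below [m + 2], hence the shift. *)
    by have := hw j; rewrite -(cvg_shiftn 2); under eq_fun do rewrite addn2.
  - move=> i dl e dl0 e0; move: i; apply: ordS => [|j].
      (* The leading coordinate is not truncated, so its error event is empty. *)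
      apply: nearW => m; apply: nearW => n.
      rewrite (_ : [set w | _] = set0).
        by rewrite indic0 (Ex_cst P 0) ltW.
      apply/seteqP; split => // w /=.
      by rewrite cons_rV0 LU0 subrr normr0 ltNge (ltW dl0).
    have [m0 hm0] := Xn_truncation_tail alpha0 meps ieps cfeps (sumA1 j) dl0 e0.
    exists m0 => // m /= m0m.
    apply: filterS (hm0 m.+2 (leqW (leqW m0m))) => n.
    rewrite (_ : [set w | dl < `|V n w _ _ - _|] = [set w | dl < `|Xn alpha eps (A j) n w -
      (scale n)^-1 * \sum_(1 <= k < m.+2) A j k * ngamma eps n k w|])//.
    by apply/seteqP; split => w /=; rewrite cons_rVS LU.
split.
  pose tail_rV (x : 'rV[R]_r.+1) : 'rV[R]_r := \row_i x ord0 (lift ord0 i).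
  have ctail i : continuous (fun x : 'rV[R]_r.+1 => tail_rV x ord0 i).
    rewrite (_ : (fun x => _) = fun x : 'rV[R]_r.+1 => x ord0 (lift ord0 i)).
      exact: coord_continuous.
    by apply/funext => x; rewrite mxE.
  have := cvg_in_distribution_map ctail cVW.
  congr (cvg_in_distribution P _ Q _).
    by apply/funext => n; apply/funext => w; apply/rowP => i; rewrite [LHS]mxE [RHS]mxE cons_rVS.
  by apply/funext => w; apply/rowP => i; rewrite [LHS]mxE [RHS]mxE cons_rVS.
have W00 : Ex Q (\1_[set w | W w ord0 ord0 = 0]) = 0.
  rewrite (_ : [set w | _] = [set w | Y 0%N w = 0]).
    apply: (positive_stable_atom0 (mY 0%N) _ s10 law0).
    by apply/andP; split; lra.
  by apply/seteqP; split => w /=; rewrite cons_rV0.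
have := cvg_in_distribution_quo mV mW W00 cVW.
have -> : (fun w => quo_rV (W w)) = fun w => \row_(i < r) Yta Y (A i) w.
  by apply/funext => w; apply/rowP => i; rewrite [LHS]mxE [RHS]mxE !cons_rVE.
(* The quotient formula holds only for [n > 1], so the two sequences of means are equal eventually
   rather than everywhere. *)
move=> cvq f cf bf; apply: cvg_trans (cvq f cf bf); apply: near_eq_cvg.
near=> n; have n1 : (1 < n)%N by near: n; exists 2%N.
congr (Ex P _); apply/funext => w; congr f; apply/rowP => i.
by rewrite [LHS]mxE [RHS]mxE !cons_rVE Xtn_quotient.
Unshelve. all: by end_near. Qed.
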